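(* Let $A_0,A_1$ be two analytic $\mathbb{R}_m$-valued functions of the real variable $x_0$, defined in an open set $\Omega_1\subset\mathbb{R}$, and let $f(x_0,\underline{x})=\sum_{j=0}^\infty\underline{x}^jA_j(x_0)$ be the unique harmonic function of this form, with first two coefficient functions $A_0,A_1$, in an axially symmetric $(m+1)$-dimensional neighbourhood $\Omega\subset\mathbb{R}^{m+1}$ of $\Omega_1$. Then $f$ can be decomposed into plane waves as follows: $$f(x_0,\underline{x})=\frac{\Gamma\left(\frac m2\right)}{2\pi^{\frac m2}}\int_{\mathbb{S}^{m-1}}\Big[\cosh\big(\langle\underline{x},\underline{\omega}\rangle\,\underline{\omega}\,\partial_{x_0}\big)[A_0](x_0)+m\,\sinh\big(\langle\underline{x},\underline{\omega}\rangle\,\underline{\omega}\,\partial_{x_0}\big)[A_1](x_0)\Big]\,dS_{\underline{\omega}} .$$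
   Context: $\mathbb{R}_m$ is the real associative Clifford algebra generated by $e_1,\dots,e_m$ with $e_je_\ell+e_\ell e_j=-2\delta_{j\ell}$; points of $\mathbb{R}^{m+1}$ are paravectors $x=x_0+\underline{x}$, $\underline{x}=\sum_{j=1}^m x_je_j$. $\mathbb{S}^{m-1}$ is the unit sphere of 1-vectors $\underline{\omega}=\sum_j\omega_je_j$, $|\underline{\omega}|=1$ (so $\underline{\omega}^2=-1$), $dS_{\underline{\omega}}$ its surface measure, and $\langle\cdot,\cdot\rangle$ the Euclidean inner product. Harmonic means $\sum_{j=0}^m\partial_{x_j}^2f=0$. The function $f$ is explicitly $$f(x_0,\underline{x})=\Gamma\left(\tfrac m2\right)\left[\sum_{j=0}^\infty\frac{(-1)^j|\underline{x}|^{2j}\partial_{x_0}^{2j}[A_0](x_0)}{2^{2j}j!\,\Gamma(\frac m2+j)}+\frac m2\,\underline{x}\sum_{j=0}^\infty\frac{(-1)^j|\underline{x}|^{2j}\partial_{x_0}^{2j}[A_1](x_0)}{2^{2j}j!\,\Gamma(\frac m2+j+1)}\right].$$ The operators are the power series $$\cosh(\langle\underline{x},\underline{\omega}\rangle\underline{\omega}\partial_{x_0})[A_0](x_0)=\sum_{j=0}^\infty\frac{(-1)^j\langle\underline{x},\underline{\omega}\rangle^{2j}\partial_{x_0}^{2j}[A_0](x_0)}{(2j)!},\qquad \sinh(\langle\underline{x},\underline{\omega}\rangle\underline{\omega}\partial_{x_0})[A_1](x_0)=\sum_{j=0}^\infty\frac{(-1)^j\langle\underline{x},\underline{\omega}\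rangle^{2j+1}\underline{\omega}\,\partial_{x_0}^{2j+1}[A_1](x_0)}{(2j+1)!}.$$
   Formalization: In the expansion of sinh(⟨x,ω⟩ω∂)[A_1] the derivative of A_1 has order 2j instead of the printed 2j+1; as printed the identity fails for A_0=0, A_1=1, where f is the vector part of x but the right-hand side is 0. *)

(* Defs.v *)
From HB Require Import structures.
From mathcomp Require Import all_boot all_order all_algebra.
From mathcomp Require Import ring.
From mathcomp Require Import all_classical all_reals all_analysis measurable_realfun.

Set Implicit Arguments.
Unset Strict Implicit.
Unset Printing Implicit Defensive.

Import Order.TTheory GRing.Theory Num.Theory.
Import numFieldNormedType.Exports.

Local Open Scope classical_set_scope.
Local Open Scope ring_scope.

Section Clifford.
Variables (R : comNzRingType) (m : nat).
Implicit Types A B C : {set 'I_m}.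

(* An element is given by its coordinates in the basis of the products        *)
(* e_B = e_(b_1) ... e_(b_k), where b_1 < ... < b_k enumerates B. It is not   *)
(* an alias of {ffun _ -> _}, which already carries the pointwise product.    *)
Record clifford := Clifford { coords : {ffun {set 'I_m} -> R} }.

Definition coord (u : clifford) A : R := coords u A.

Coercion coord : clifford >-> Funclass.

Definition mk_clifford (F : {set 'I_m} -> R) : clifford := Clifford [ffun B => F B].

HB.instance Definition _ := [isNew for coords].
HB.instance Definition _ := [Choice of clifford by <:].

Lemma coordE (F : {set 'I_m} -> R) B : mk_clifford F B = F B.
Proof. by rewrite /coord ffunE. Qed.

Lemma cliffordP (u v : clifford) : (forall B, u B = v B) -> u = v.
Proof. by move=> uv; apply/val_inj/ffunP. Qed.

Definition clifford_zero := mk_clifford (fun=> 0).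
Definition clifford_opp (u : clifford) := mk_clifford (fun B => - u B).
Definition clifford_add (u v : clifford) := mk_clifford (fun B => u B + v B).
Definition clifford_scale (a : R) (u : clifford) :=
  mk_clifford (fun B => a * u B).

Lemma clifford_addA : associative clifford_add.
Proof. by move=> u v w; apply: cliffordP => B; rewrite !coordE addrA. Qed.

Lemma clifford_addC : commutative clifford_add.
Proof. by move=> u v; apply: cliffordP => B; rewrite !coordE addrC. Qed.

Lemma clifford_add0 : left_id clifford_zero clifford_add.
Proof. by move=> u; apply: cliffordP => B; rewrite !coordE add0r. Qed.

Lemma clifford_addN : left_inverse clifford_zero clifford_opp clifford_add.
Proof. by move=> u; apply: cliffordP => B; rewrite !coordE addNr. Qed.

HB.instance Definition _ := GRing.isZmodule.Build clifford
  clifford_addA clifford_addC clifford_add0 clifford_addN.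

Lemma clifford_scaleA (a b : R) (u : clifford) :
  clifford_scale a (clifford_scale b u) = clifford_scale (a * b) u.
Proof. by apply: cliffordP => B; rewrite !coordE mulrA. Qed.

Lemma clifford_scale1 : left_id 1 clifford_scale.
Proof. by move=> u; apply: cliffordP => B; rewrite !coordE mul1r. Qed.

Lemma clifford_scaleDr : right_distributive clifford_scale +%R.
Proof. by move=> a u v; apply: cliffordP => B; rewrite !coordE mulrDr. Qed.

Lemma clifford_scaleDl (u : clifford) :
  {morph clifford_scale^~ u : a b / a + b}.
Proof. by move=> a b; apply: cliffordP => B; rewrite !coordE mulrDl. Qed.

HB.instance Definition _ := GRing.Zmodule_isLmodule.Build R clifford
  clifford_scaleA clifford_scale1 clifford_scaleDr clifford_scaleDl.

Lemma coord0 B : (0 : clifford) B = 0.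
Proof. exact: coordE. Qed.

Lemma coordN (u : clifford) B : (- u) B = - u B.
Proof. exact: coordE. Qed.

Lemma coordD (u v : clifford) B : (u + v) B = u B + v B.
Proof. exact: coordE. Qed.

Lemma coordZ (a : R) (u : clifford) B : (a *: u) B = a * u B.
Proof. exact: coordE. Qed.

Definition symdiff A B : {set 'I_m} := ((A :\: B) :|: (B :\: A))%SET.

(* e_A e_B = blade_sign A B *: e_(symdiff A B): one factor -1 for each        *)
(* transposition e_i e_j = - e_j e_i with i > j, and one for each e_i^2 = -1. *)
Definition blade_sign A B : R :=
  \prod_(i in A) \prod_(j in B) (if (j <= i)%N then -1 else 1).

Definition clifford_mul (u v : clifford) : clifford :=
  mk_clifford (fun C =>
    \sum_A blade_sign A (symdiff A C) * u A * v (symdiff A C)).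

Definition clifford_one : clifford := mk_clifford (fun C => (C == finset.set0)%:R).

Lemma in_symdiff i A B : (i \in symdiff A B) = (i \in A) (+) (i \in B).
Proof. by rewrite !inE; case: (i \in A); case: (i \in B). Qed.

Lemma symdiffA : associative symdiff.
Proof. by move=> A B C; apply/setP => i; rewrite !in_symdiff addbA. Qed.

Lemma symdiffK A : involutive (symdiff A).
Proof. by move=> B; apply/setP => i; rewrite !in_symdiff addKb. Qed.

Lemma symdiff0 A : symdiff A finset.set0 = A.
Proof. by apply/setP => i; rewrite in_symdiff inE addbF. Qed.

Lemma symdiff_eq0 A B : (symdiff A B == finset.set0) = (B == A).
Proof.
apply/eqP/eqP => [AB0|->]; last by apply/setP => i; rewrite in_symdiff inE addbb.
by rewrite -[B](symdiffK A) AB0 symdiff0.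
Qed.

Lemma symdiffv A : symdiff A A = finset.set0.
Proof. by apply/eqP; rewrite symdiff_eq0. Qed.

Lemma prod_symdiff (F : 'I_m -> R) A B : (forall i, F i * F i = 1) ->
  \prod_(i in symdiff A B) F i = \prod_(i in A) F i * \prod_(i in B) F i.
Proof.
move=> F2; rewrite big_mkcond [X in X * _]big_mkcond [X in _ * X]big_mkcond /=.
rewrite -big_split /=; apply: eq_bigr => i _; rewrite in_symdiff.
by case: (i \in A); case: (i \in B); rewrite /= ?F2 ?mulr1 ?mul1r.
Qed.

Lemma sign_sq (b : bool) : (if b then -1 else 1 : R) * (if b then -1 else 1) = 1.
Proof. by case: b; rewrite ?mulrNN mulr1. Qed.

Lemma blade_signDl A B C :
  blade_sign (symdiff A B) C = blade_sign A C * blade_sign B C.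
Proof.
apply: prod_symdiff => i; rewrite -big_split /= big1// => j _.
exact: sign_sq.
Qed.

Lemma blade_signDr A B C :
  blade_sign A (symdiff B C) = blade_sign A B * blade_sign A C.
Proof.
rewrite /blade_sign -big_split /=; apply: eq_bigr => i _.
by apply: prod_symdiff => j; exact: sign_sq.
Qed.

Lemma clifford_mulA : associative clifford_mul.
Proof.
move=> u v w; apply: cliffordP => C; rewrite !coordE.
under eq_bigr do rewrite coordE mulr_sumr.
under [RHS]eq_bigr do rewrite coordE mulr_sumr mulr_suml.
rewrite [RHS]exchange_big /=; apply: eq_bigr => A _.
rewrite [RHS](reindex_inj (can_inj (symdiffK A))) /=; apply: eq_bigr => B _.
rewrite symdiffK.
have -> : symdiff (symdiff A B) C = symdiff B (symdiff A C).
  by apply/setP => i; rewrite !in_symdiff [_ (+) (i \in B)]addbC addbA.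
set E := symdiff B _.
have -> : symdiff A C = symdiff B E by rewrite /E symdiffK.
rewrite blade_signDl blade_signDr.
ring.
Qed.

Lemma blade_sign0l A : blade_sign finset.set0 A = 1.
Proof. by rewrite /blade_sign big_set0. Qed.

Lemma blade_sign0r A : blade_sign A finset.set0 = 1.
Proof. by rewrite /blade_sign big1// => i _; rewrite big_set0. Qed.

Lemma symdiffC A B : symdiff A B = symdiff B A.
Proof. by apply/setP => i; rewrite !in_symdiff addbC. Qed.

Lemma clifford_mul1l : left_id clifford_one clifford_mul.
Proof.
move=> u; apply: cliffordP => C; rewrite coordE (bigD1 finset.set0)//= big1 => [|A A0].
  by rewrite coordE eqxx blade_sign0l !mul1r symdiffC symdiff0 addr0.
by rewrite coordE (negPf A0) mulr0 mul0r.
Qed.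

Lemma clifford_mul1r : right_id clifford_one clifford_mul.
Proof.
move=> u; apply: cliffordP => C; rewrite coordE (bigD1 C)//= big1 => [|A AC].
  by rewrite symdiffv blade_sign0r coordE eqxx mul1r mulr1 addr0.
by rewrite coordE symdiff_eq0 eq_sym (negPf AC) mulr0.
Qed.

Lemma clifford_mulDl : left_distributive clifford_mul +%R.
Proof.
move=> u v w; apply: cliffordP => C; rewrite !coordE -big_split /=.
by apply: eq_bigr => A _; rewrite !coordE mulrDr mulrDl.
Qed.

Lemma clifford_mulDr : right_distributive clifford_mul +%R.
Proof.
move=> u v w; apply: cliffordP => C; rewrite !coordE -big_split /=.
by apply: eq_bigr => A _; rewrite !coordE mulrDr.
Qed.

Lemma clifford_one_neq0 : clifford_one != 0.
Proof.
by apply/eqP => /(congr1 (coord^~ finset.set0))/eqP; rewrite !coordE eqxx oner_eq0.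
Qed.

HB.instance Definition _ := GRing.Zmodule_isNzRing.Build clifford
  clifford_mulA clifford_mul1l clifford_mul1r clifford_mulDl clifford_mulDr
  clifford_one_neq0.

Lemma clifford_scalerAl (a : R) (u v : clifford) : a *: (u * v) = (a *: u) * v.
Proof.
apply: cliffordP => C; rewrite coordZ !coordE mulr_sumr; apply: eq_bigr => A _.
by rewrite coordZ; ring.
Qed.

HB.instance Definition _ := GRing.Lmodule_isLalgebra.Build R clifford
  clifford_scalerAl.

Lemma clifford_scalerAr (a : R) (u v : clifford) : a *: (u * v) = u * (a *: v).
Proof.
apply: cliffordP => C; rewrite coordZ !coordE mulr_sumr; apply: eq_bigr => A _.
by rewrite coordZ; ring.
Qed.

HB.instance Definition _ := GRing.Lalgebra_isAlgebra.Build R clifford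
  clifford_scalerAr.

Definition blade A : clifford := mk_clifford (fun C => (C == A)%:R).

Lemma mul_blade A B : blade A * blade B = blade_sign A B *: blade (symdiff A B).
Proof.
apply: cliffordP => C; rewrite coordZ [LHS]coordE (bigD1 A)//= big1 => [|D DA].
  rewrite !coordE eqxx mulr1 addr0.
  have [->|CAB] := eqVneq C (symdiff A B); first by rewrite symdiffK eqxx.
  by rewrite -(can_eq (symdiffK A)) symdiffK (negPf CAB) !mulr0.
by rewrite coordE (negPf DA) mulr0 mul0r.
Qed.

Definition gen (j : 'I_m) : clifford := blade (finset.set1 j).

Lemma gen_rel (j l : 'I_m) :
  gen j * gen l + gen l * gen j = (- 2 * (j == l)%:R) *: 1.
Proof.
rewrite !mul_blade [symdiff [set l]%SET _]symdiffC -scalerDl /blade_sign.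
rewrite !big_set1; have [->|jl] := eqVneq j l.
  by rewrite leqnn symdiffv mulr1 -opprD.
have -> : (if (l <= j)%N then -1 else 1) = - (if (j <= l)%N then -1 else 1) :> R.
  by case: ltngtP jl => [||/val_inj ->]; rewrite ?opprK ?eqxx.
by rewrite addNr mulr0 !scale0r.
Qed.

End Clifford.

Section SurfaceMeasure.
Variable R : realType.
Definition tcons n (p : measurableTypeR R * n.-tuple (measurableTypeR R)) :
  n.+1.-tuple (measurableTypeR R) := [tuple of p.1 :: p.2].

Lemma measurable_tcons n : measurable_fun [set: _] (@tcons n).
Proof. exact: measurable_cons. Qed.

Section lebesgue_tcons.
Variables (n : nat)
  (mu : {sigma_finite_measure set (n.-tuple (measurableTypeR R)) -> \bar R}).

Definition lebesgue_tcons : set (n.+1.-tuple (measurableTypeR R)) -> \bar R :=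
  pushforward (@lebesgue_measure R \x mu)%E (@tcons n).


Let lebesgue_tcons0 : lebesgue_tcons set0 = 0%E.
Proof. by rewrite /lebesgue_tcons /pushforward preimage_set0 measure0. Qed.

Let lebesgue_tcons_ge0 A : (0 <= lebesgue_tcons A)%E.
Proof. rewrite /lebesgue_tcons /pushforward; exact: measure_ge0. Qed.

Let lebesgue_tcons_sigma_additive : semi_sigma_additive lebesgue_tcons.
Proof.
rewrite /lebesgue_tcons; apply: measure_semi_sigma_additive.
exact: measurable_tcons.
Qed.

HB.instance Definition _ := isMeasure.Build _ _ _ lebesgue_tcons
  lebesgue_tcons0 lebesgue_tcons_ge0 lebesgue_tcons_sigma_additive.

Let lebesgue_tcons_sigma_finite : sigma_finite setT lebesgue_tcons.
Proof.
have /sigma_finiteP[F [FT ndF Ffin]] := sigma_finiteT (@lebesgue_measure R).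
have /sigma_finiteP[G [GT ndG Gfin]] := sigma_finiteT mu.
pose uncons (y : n.+1.-tuple (measurableTypeR R)) := (thead y, [tuple of behead y]).
have muncons : measurable_fun [set: _] uncons.
  by apply/measurable_fun_pair; [exact: measurable_tnth|exact: measurable_behead].
have consK p : uncons (tcons p) = p.
  by case: p => t y; congr (_, _); apply/val_inj.
exists (fun k => uncons @^-1` (F k `*` G k)).
  rewrite -preimage_bigcup -[LHS](preimage_setT uncons); congr (_ @^-1` _).
  apply/seteqP; split=> // -[t y] _.
  have [i _ Fi] : (\bigcup_i F i) t by rewrite -FT.
  have [j _ Gj] : (\bigcup_i G i) y by rewrite -GT.
  exists (maxn i j) => //; split => /=.
  - by move: t Fi; exact/subsetPset/ndF/leq_maxl.
  - by move: y Gj; exact/subsetPset/ndG/leq_maxr.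
move=> k; have [mFk Fkfin] := Ffin k; have [mGk Gkfin] := Gfin k; split.
  rewrite -[X in measurable X]setTI; apply: muncons => //.
  exact: measurableX.
rewrite /lebesgue_tcons /pushforward (_ : _ @^-1` _ = F k `*` G k).
  by rewrite product_measure1E// lte_mul_pinfty// ge0_fin_numE.
by apply/funext => p; rewrite /preimage /mkset consK.
Qed.

HB.instance Definition _ := Measure_isSigmaFinite.Build _ _ _ lebesgue_tcons
  lebesgue_tcons_sigma_finite.

End lebesgue_tcons.

(* Lebesgue measure on R^n, as an iterated product measure. *)
Fixpoint lebesgue_tuple n :
    {sigma_finite_measure set (n.-tuple (measurableTypeR R)) -> \bar R} :=
  match n with
  | 0 => \d_[tuple]
  | n'.+1 => lebesgue_tcons (lebesgue_tuple n')
  end.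

Variable m : nat.
Local Notation vecT := (m.-tuple (measurableTypeR R)).

Definition tnorm (y : vecT) : R := Num.sqrt (\sum_j tnth y j ^+ 2).

Definition tnormalize (y : vecT) : vecT := [tuple tnth y j / tnorm y | j < m].

Lemma measurable_coord (j : 'I_m) :
  measurable_fun [set: vecT] (fun y => tnth y j : R).
Proof. exact: measurable_tnth. Qed.

Lemma measurable_tnorm : measurable_fun [set: vecT] tnorm.
Proof.
apply: (@measurableT_comp _ _ _ _ _ _ (@Num.sqrt R)).
  by apply: continuous_measurable_fun; exact: sqrt_continuous.
apply: measurable_sum => j; apply: measurable_funX; exact: measurable_coord.
Qed.

Lemma measurable_tnormalize : measurable_fun [set: vecT] tnormalize.
Proof.
apply/measurable_fun_tnthP => j.
rewrite [X in measurable_fun _ X](_ : _ = fun y => (tnth y j : R) * tnorm y `^ (-1)).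
  apply: measurable_funM; first exact: measurable_coord.
  apply: (@measurableT_comp _ _ _ _ _ _ (@powR R ^~ (-1))).
    exact: measurable_powR.
  exact: measurable_tnorm.
by apply/funext => y; rewrite /= tnth_mktuple powR_inv1// sqrtr_ge0.
Qed.

Definition unit_sphere : set vecT := [set w | tnorm w = 1].

Definition punctured_ball : set vecT := [set y | 0 < tnorm y <= 1].

Lemma measurable_punctured_ball : measurable punctured_ball.
Proof.
rewrite -[X in measurable X]setTI.
exact: (measurable_tnorm measurableT (measurable_itv `]0, 1])).
Qed.

(* The cone measure: sigma(A) = m * lambda({r w : 0 < r <= 1, w in A}).       *)
Definition surface_measure (A : set vecT) : \bar R :=
  (m%:R%:E * lebesgue_tuple m (tnormalize @^-1` A `&` punctured_ball))%E.

Let surface_measureE : surface_measure =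
  pushforward (mscale m%:R%:nng
    (mrestr (lebesgue_tuple m) measurable_punctured_ball)) tnormalize.
Proof. by []. Qed.

Let surface_measure0 : surface_measure set0 = 0%E.
Proof. by rewrite /surface_measure preimage_set0 set0I measure0 mule0. Qed.

Let surface_measure_ge0 A : (0 <= surface_measure A)%E.
Proof. by apply: mule_ge0; rewrite ?lee_fin. Qed.

Let surface_measure_sigma_additive : semi_sigma_additive surface_measure.
Proof.
rewrite surface_measureE.
apply: measure_semi_sigma_additive.
exact: measurable_tnormalize.
Qed.

HB.instance Definition _ := isMeasure.Build _ _ _ surface_measure
  surface_measure0 surface_measure_ge0 surface_measure_sigma_additive.

End SurfaceMeasure.

Section Analysis.
Variables (R : realType) (m : nat).
Local Notation Cl := (clifford R m).
Local Notation point := 'rV[R]_m.+1.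
Local Notation sphere_point := (m.-tuple (measurableTypeR R)).
Implicit Types (A : R -> Cl) (x y : point) (u : nat -> Cl).

(* Limits, derivatives and integrals of Cl-valued maps are coordinatewise.    *)
Definition has_sum u (s : Cl) :=
  forall B, series (fun j => u j B) @ \oo --> s B.

Definition is_summable u := exists s, has_sum u s.

Definition csum u : Cl := mk_clifford (fun B => limn (series (fun j => u j B))).

Definition cderivn n A (t : R) : Cl :=
  mk_clifford (fun B => derive1n n (fun s => A s B) t).

Definition analytic_on (O1 : set R) A :=
  forall a, O1 a -> exists c : nat -> Cl, exists2 r : R, 0 < r &
    forall t, `|t - a| < r -> has_sum (fun n => (t - a) ^+ n *: c n) (A t).

Definition sphere_integrable (F : sphere_point -> Cl) :=
  forall B, (@surface_measure R m).-integrable (@unit_sphere R m)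
    (fun w => (F w B)%:E).

Definition sphere_int (F : sphere_point -> Cl) : Cl :=
  mk_clifford (fun B => \int[@surface_measure R m]_(w in @unit_sphere R m) F w B).

(* The paravector x_0 + sum_(j = 1)^m x_j e_j is the row (x_0, ..., x_m).     *)
Definition re x : R := x ord0 ord0.

Definition im x : 'rV[R]_m := \row_j x ord0 (lift ord0 j).

(* mathcomp-analysis norms row vectors by the maximum of their entries.       *)
Definition enorm (v : 'rV[R]_m) : R := Num.sqrt (\sum_j v ord0 j ^+ 2).

Definition vec (v : 'rV[R]_m) : Cl := \sum_j v ord0 j *: gen R j.

Definition row_of (w : sphere_point) : 'rV[R]_m := \row_j tnth w j.

Definition dotp (v w : 'rV[R]_m) : R := \sum_j v ord0 j * w ord0 j.

(* O lies over O1 because the coefficient functions are only given on O1.     *)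
Definition axial_nbhd (O1 : set R) (O : set point) :=
  [/\ open O,
      forall x y, O x -> re y = re x -> enorm (im y) = enorm (im x) -> O y,
      forall x, O1 (re x) -> im x = 0 -> O x
    & forall x, O x -> O1 (re x)].

Definition partial (i : 'I_m.+1) (g : point -> R) : point -> R :=
  'D_(delta_mx ord0 i) g.

Definition C2_on (O : set point) (g : point -> R) :=
  forall x, O x -> {for x, continuous g} /\
    forall i j : 'I_m.+1,
      [/\ derivable g x (delta_mx ord0 i),
          {for x, continuous (partial i g)},
          derivable (partial i g) x (delta_mx ord0 j)
        & {for x, continuous (partial j (partial i g))}].

Definition harmonic_on (O : set point) (f : point -> Cl) :=
  forall B, C2_on O (fun x => f x B) /\
    forall x, O x -> \sum_i partial i (partial i (fun y => f y B)) x = 0.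

Definition Gamma (a : R) : R :=
  \int[@lebesgue_measure R]_(t in `]0, +oo[) (t `^ (a - 1) * expR (- t)).

Definition even_term A x (j : nat) : Cl :=
  ((-1) ^+ j * enorm (im x) ^+ (2 * j) /
    (2 ^+ (2 * j) * j`!%:R * Gamma (m%:R / 2 + j%:R))) *:
  cderivn (2 * j) A (re x).

Definition odd_term A x (j : nat) : Cl :=
  ((-1) ^+ j * enorm (im x) ^+ (2 * j) /
    (2 ^+ (2 * j) * j`!%:R * Gamma (m%:R / 2 + j%:R + 1))) *:
  cderivn (2 * j) A (re x).

Definition cosh_term A x (w : sphere_point) (j : nat) : Cl :=
  ((-1) ^+ j * dotp (im x) (row_of w) ^+ (2 * j) / (2 * j)`!%:R) *:
  cderivn (2 * j) A (re x).

(* The j-th term of sinh(<x, w> w d/dx_0) (d/dx_0)^-1 [A]: the derivative has *)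
(* order 2j, one less than the power of <x, w>, to match odd_term. With order *)
(* 2j + 1 the plane wave decomposition fails already for A_0 = 0 and A_1 = 1, *)
(* where f is the vector part of x but all derivatives of A_1 vanish.         *)
Definition sinh_term A x (w : sphere_point) (j : nat) : Cl :=
  ((-1) ^+ j * dotp (im x) (row_of w) ^+ (2 * j).+1 / ((2 * j).+1)`!%:R) *:
  (vec (row_of w) * cderivn (2 * j) A (re x)).

Definition plane_wave A0 A1 x (w : sphere_point) : Cl :=
  csum (cosh_term A0 x w) + m%:R *: csum (sinh_term A1 x w).

End Analysis.

(* Main.v *)
(* Both series are integrated termwise over the sphere, which reduces the claim to
   the moments of <v, w> and <v, w> w_k for the surface measure. In polar
   coordinates the even moments are quotients of Gaussian integrals over R^m by
   Gaussian integrals over the half-line, and the latter are values of Gamma at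
   half-integers; the moments with one extra factor w_k follow by polarization.
   To dominate the series uniformly in w, pass to a point y of the open set O
   with the same real part as x and a longer vector part: the terms of the
   series given at y are bounded, and the factor Gamma(m/2 + j) 4^j j! / (2j)!
   separating them from the terms of cosh and sinh grows slower than any
   geometric sequence. *)
Require Import Defs.
From mathcomp Require Import all_boot all_order all_algebra.
From mathcomp Require Import ring lra.
From mathcomp Require Import all_classical all_reals all_analysis measurable_realfun.

Import Order.TTheory GRing.Theory Num.Theory.
Import numFieldNormedType.Exports.

Local Open Scope classical_set_scope.
Local Open Scope ring_scope.

Set Implicit Arguments.
Unset Strict Implicit.
Unset Printing Implicit Defensive.

(** * Lebesgue measure on tuples *)

(** Up to the even moments, every integrand is nonnegative and every integral is an extended real.
    Tonelli then applies without any finiteness known in advance; even the finite mass of the sphere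
    comes out as the zeroth moment. Moments whose integrand changes sign, such as those with the
    factor w_k, are only handled once integrability follows from boundedness on the sphere. The
    longer point y is forced by the growth factor: convergence at x itself bounds the terms there
    but leaves nothing to pay for that factor. Between x and y there is a gain of (|x|/|y|)^(2j).
    One half of the exponent absorbs the growth, the other half remains as the geometric decay that
    dominates the plane wave series. *)

Section RestrictedIntegral.
Context d (T : measurableType d) (R : realType).
Variables (mu : {measure set T -> \bar R}) (D : set T) (mD : measurable D).

(** Split [E] along [D]: on the part inside [D] both measures have the same values on measurable
    subsets, and on the part outside the restricted measure is the zero measure. *)
Lemma ge0_integral_mrestr (E : set T) (F : T -> \bar R) :
  measurable E -> measurable_fun E F -> (forall x, E x -> (0 <= F x)%E) ->
  (\int[mrestr mu mD]_(x in E) F x = \int[mu]_(x in E `&` D) F x)%E.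
Proof.
move=> mE mF F0.
have mED : measurable (E `&` D) by exact: measurableI.
rewrite -[in LHS](setUIDK E D) ge0_integral_setU//=; first last.
- by rewrite disj_set2E; apply/eqP/seteqP; split=> // x [[_ Dx] [_ /(_ Dx)]].
- by move=> x [] [Ex _]; exact: F0.
- by rewrite setUIDK.
- exact: measurableD.
rewrite [X in (_ + X)%E](_ : _ = 0%E) ?adde0.
  apply: eq_measure_integral => A mA AED; rewrite /mrestr/=.
  by congr (mu _); apply/setIidl => x /AED[].
rewrite -(integral_measure_zero (E `\` D) F).
apply: eq_measure_integral => A mA AED; rewrite /mrestr/= /mzero/=.
suff AD : A `&` D = set0 by rewrite -[LHS]/(mu (A `&` D)) AD measure0.
by apply/seteqP; split=> // x [/AED[]].
Qed.

End RestrictedIntegral.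

Section LebesgueScaling.
Variable R : realType.
Local Notation mu := (@lebesgue_measure R).

(** By uniqueness of Lebesgue measure: the rescaled pushforward gives half-open intervals their
    length. *)
Lemma lebesgue_measure_scale (s : R) (A : set (measurableTypeR R)) :
  0 < s -> measurable A -> (s%:E * mu ( *%R s @^-1` A) = mu A)%E.
Proof.
move=> s0 mA; apply/esym.
have ms : measurable_fun setT ( *%R s : measurableTypeR R -> measurableTypeR R).
  exact: mulrl_measurable.
pose nu : {measure set (measurableTypeR R) -> \bar R} :=
  mscale (NngNum (ltW s0)) (pushforward mu ( *%R s : _ -> measurableTypeR R)).
rewrite -[RHS]/(nu ms A); apply: lebesgue_measure_unique => // _ [[a b]] _ <-.
rewrite -[RHS]/(s%:E * mu ( *%R s @^-1` `]a, b]))%E.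
have -> : *%R s @^-1` `]a, b] = `]a / s, b / s]%classic.
  apply/seteqP; split=> t /=; rewrite !in_itv/= ltr_pdivrMr// ler_pdivlMr//.
    by rewrite ![t * s]mulrC.
  by rewrite ![t * s]mulrC.
rewrite !lebesgue_measure_itv/= !lte_fin ltr_pM2r ?invr_gt0//.
case: ifP => _; last by rewrite mule0.
by rewrite -!EFinD -EFinM -mulrBl mulrC divfK// gt_eqF.
Qed.

Lemma ge0_integral_scale (s : R) (F : R -> \bar R) :
  0 < s -> measurable_fun setT F -> (forall t, (0 <= F t)%E) ->
  (s%:E * \int[mu]_t F (s * t)%R = \int[mu]_t F t)%E.
Proof.
move=> s0 mF F0.
have ms : measurable_fun setT ( *%R s : measurableTypeR R -> measurableTypeR R).
  exact: mulrl_measurable.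
have mFs : measurable_fun setT (fun t : measurableTypeR R => F (s * t)%R).
  exact: measurableT_comp.
rewrite -[RHS](_ : \int[mscale (NngNum (ltW s0))
  (pushforward mu ( *%R s : _ -> measurableTypeR R))]_t F t = _)%E.
  by rewrite ge0_integral_mscale//= ge0_integral_pushforward.
by apply: eq_measure_integral => A mA _; exact: lebesgue_measure_scale.
Qed.

Lemma ge0_integral_opp (F : R -> \bar R) :
  measurable_fun setT F -> (forall t, (0 <= F t)%E) ->
  (\int[mu]_t F (- t)%R = \int[mu]_t F t)%E.
Proof.
move=> mF F0.
have mN : measurable_fun setT (-%R : measurableTypeR R -> measurableTypeR R).
  exact: oppr_measurable.
rewrite -[RHS](_ : \int[pushforward mu (-%R : _ -> measurableTypeR R)]_t F t = _)%E.
  by rewrite ge0_integral_pushforward.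
by apply: eq_measure_integral => A mA _; exact: lebesgue_measureN.
Qed.

End LebesgueScaling.

Section LebesgueTuple.
Variable R : realType.
Local Notation mu := (@lebesgue_measure R).
Local Notation lam n := (@lebesgue_tuple R n).
Local Notation vecT n := (n.-tuple (measurableTypeR R)).

Lemma integral_lebesgue_tcons n (F : vecT n.+1 -> \bar R) :
  measurable_fun setT F -> (forall y, (0 <= F y)%E) ->
  (\int[lam n.+1]_y F y = \int[mu]_t \int[lam n]_y F (tcons (t, y)))%E.
Proof.
move=> mF F0; rewrite -[LHS]/(\int[pushforward (mu \x lam n)%E (@tcons R n)]_y F y)%E.
rewrite ge0_integral_pushforward//; last exact: measurable_tcons.
rewrite fubini_tonelli1//=; apply: measurableT_comp => //; exact: measurable_tcons.
Qed.

Lemma measurable_integral_tcons n (F : vecT n.+1 -> \bar R) :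
  measurable_fun setT F -> (forall y, (0 <= F y)%E) ->
  measurable_fun setT (fun t => \int[lam n]_y F (tcons (t, y)))%E.
Proof.
move=> mF F0.
apply: (@measurable_fun_fubini_tonelli_F _ _ _ _ _ (lam n) (F \o @tcons R n)) => [|p].
  apply: measurableT_comp => //; exact: measurable_tcons.
exact: F0.
Qed.

Lemma measurable_tcons_l n (t : R) :
  measurable_fun setT (fun y => tcons (t, y) : vecT n.+1).
Proof.
exact: (measurable_cons (measurable_cst _) (@measurable_id _ _ _)).
Qed.

Definition tscale n (s : R) (y : vecT n) : vecT n := [tuple s * tnth y i | i < n].

Lemma tscale_tcons n s t (y : vecT n) :
  tscale s (tcons (t, y)) = tcons (s * t, tscale s y).
Proof.
apply: eq_from_tnth => i; rewrite tnth_mktuple; case: (unliftP ord0 i) => [j|] ->.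
  by rewrite !tnthS tnth_mktuple.
by rewrite !tnth0.
Qed.

Lemma measurable_tscale n s : measurable_fun setT (@tscale n s).
Proof.
apply/measurable_fun_tnthP => i.
rewrite [X in measurable_fun _ X](_ : _ = fun y => (s * tnth y i)).
  apply: measurable_funM; [exact: measurable_cst|exact: measurable_coord].
by apply/funext => y; rewrite /= tnth_mktuple.
Qed.

(** Each coordinate contributes one factor [s]. Dilations are the only change of variables in R^n
    that the polar coordinate formula requires. *)
Lemma integral_lebesgue_tscale n s (F : vecT n -> \bar R) :
  0 < s -> measurable_fun setT F -> (forall y, (0 <= F y)%E) ->
  ((s ^+ n)%:E * \int[lam n]_y F (tscale s y) = \int[lam n]_y F y)%E.
Proof.
move=> s0; elim: n F => [|n IH] F mF F0.
  rewrite expr0 mul1e; apply: eq_integral => y _; congr F; apply: eq_from_tnth => -[]//.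
have mFs : measurable_fun setT (fun y => F (tscale s y)).
  by apply: measurableT_comp => //; exact: measurable_tscale.
rewrite !integral_lebesgue_tcons//.
rewrite -[RHS](ge0_integral_scale s0)//; first last.
- by move=> t; exact: integral_ge0.
- exact: measurable_integral_tcons.
rewrite exprS EFinM -muleA -ge0_integralZl //.
- congr (_ * _)%E; apply: eq_integral => t _.
  under eq_integral do rewrite tscale_tcons.
  rewrite (IH (fun y => F (tcons (s * t, y)))) //.
  apply: measurableT_comp => //; exact: measurable_tcons_l.
- exact: (measurable_integral_tcons mFs).
- by move=> t _; exact: integral_ge0.
- by rewrite lee_fin exprn_ge0// ltW.
Qed.

End LebesgueTuple.

(** * Polar coordinates *)

Section SpherePolar.
Variable R : realType.
Local Notation mu := (@lebesgue_measure R).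
Local Notation lam n := (@lebesgue_tuple R n).
Local Notation vecT n := (n.-tuple (measurableTypeR R)).

Lemma tnorm_ge0 n (y : vecT n) : 0 <= tnorm y.
Proof. exact: sqrtr_ge0. Qed.

Lemma sqr_tnorm n (y : vecT n) : tnorm y ^+ 2 = \sum_j tnth y j ^+ 2.
Proof. by rewrite sqr_sqrtr// sumr_ge0// => j _; exact: sqr_ge0. Qed.

Lemma tnorm_eq0 n (y : vecT n) j : tnorm y = 0 -> tnth y j = 0.
Proof.
move=> y0; have /eqP := sqr_tnorm y.
rewrite y0 expr0n/= eq_sym psumr_eq0; last by move=> i _; exact: sqr_ge0.
by move=> /allP/(_ j); rewrite mem_index_enum => /(_ isT)/=; rewrite sqrf_eq0 => /eqP.
Qed.

Lemma tnorm_tscale n (s : R) (y : vecT n) : 0 <= s -> tnorm (tscale s y) = s * tnorm y.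
Proof.
move=> s0; rewrite /tnorm; under eq_bigr do rewrite tnth_mktuple exprMn.
by rewrite -mulr_sumr sqrtrM ?sqr_ge0// sqrtr_sqr ger0_norm.
Qed.

Lemma tnormalize_tscale n (s : R) (y : vecT n) :
  0 < s -> tnormalize (tscale s y) = tnormalize y.
Proof.
move=> s0; apply: eq_from_tnth => i; rewrite !tnth_mktuple tnorm_tscale ?ltW//.
by rewrite -mulf_div divff ?gt_eqF// mul1r.
Qed.

Lemma tnorm_tnormalize n (y : vecT n) : 0 < tnorm y -> tnorm (tnormalize y) = 1.
Proof.
move=> y0; rewrite (_ : tnormalize y = tscale (tnorm y)^-1 y).
  by rewrite tnorm_tscale ?invr_ge0 ?ltW// mulVf// gt_eqF.
by apply: eq_from_tnth => i; rewrite !tnth_mktuple mulrC.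
Qed.

Lemma measurable_tnorm_eq0 n : measurable [set y : vecT n | tnorm y = 0].
Proof.
rewrite -[X in measurable X]setTI.
exact: (measurable_tnorm measurableT (measurable_set1 0)).
Qed.

(** A vector of norm 0 has first coordinate 0, so all slices except the one over the single point 0
    are empty. *)
Lemma lebesgue_tnorm_eq0 n : lam n.+1 [set y : vecT n.+1 | tnorm y = 0] = 0%E.
Proof.
have mN := @measurable_tnorm_eq0 n.+1.
rewrite -[X in lam n.+1 X]setIT -(@integral_indic _ _ _ (lam n.+1) _ measurableT)//.
have mF : measurable_fun setT (fun y : vecT n.+1 => (\1_[set y | tnorm y = 0] y : R)%:E).
  exact/measurable_EFinP/measurable_indic.
rewrite integral_lebesgue_tcons//.
have F0 (y : vecT n.+1) : (0 <= (\1_[set y | tnorm y = 0] y : R)%:E)%E by rewrite lee_fin.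
have mG := measurable_integral_tcons mF F0.
rewrite -(@integral_setD1 _ _ 0)//; [|exact: measurableD|exact: measurable_funTS mG].
apply: integral0_eq => t -[_ /= t0]; apply: integral0_eq => y _.
rewrite indicE memNset//= => /(@tnorm_eq0 n.+1 _ ord0); rewrite tnth0; exact: t0.
Qed.

Lemma is_derive_exprn n (x : R) : is_derive x 1 (fun z : R => z ^+ n) (n%:R * x ^+ n.-1).
Proof.
apply: DeriveDef; first exact: exprn_derivable.
by rewrite exp_derive [LHS]mulr1.
Qed.

(* The inverse is written as a power: measurability is available for powR. *)
Lemma tail_integral n (r : R) : 0 < r ->
  (\int[mu]_s (if (r <= s)%R then (n.+1%:R * r ^+ n.+1 * (s `^ (-1)) ^+ n.+2)%R
    else 0%R)%:E = 1)%E.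
Proof.
move=> r0.
transitivity (\int[mu]_(s in `[r, +oo[) (n.+1%:R * r ^+ n.+1 * (s^-1) ^+ n.+2)%:E)%E.
  rewrite [RHS]integral_mkcond; apply: eq_integral => s _; rewrite patchE.
  rewrite mem_setE in_itv/= andbT; case: ifPn => // rs.
  by rewrite powR_inv1// ltW// (lt_le_trans r0).
have dF (s : R) : r <= s -> is_derive s 1 (fun s : R => - (r * s^-1) ^+ n.+1)
    (n.+1%:R * r ^+ n.+1 * (s^-1) ^+ n.+2).
  move=> rs; have s0 : s != 0 by rewrite gt_eqF// (lt_le_trans r0).
  have D1 : is_derive s 1 (fun s : R => r * s^-1) (r * - (s^-1 ^+ 2)).
    apply: (is_derive_eq (is_deriveZ r (is_deriveV s0 (is_derive_id s 1)))).
    by rewrite /GRing.scale/= mulr1 exprVn.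
  have D2 : is_derive (r * s^-1) 1 (fun z : R => - z ^+ n.+1)
      (- (n.+1%:R * (r * s^-1) ^+ n)).
    exact: (is_deriveN (is_derive_exprn n.+1 (r * s^-1))).
  have D3 := is_derive1_comp (f := fun z : R => - z ^+ n.+1)
    (g := fun s : R => r * s^-1) D2 D1.
  apply: (is_derive_eq D3).
  by rewrite exprMn !exprS; ring.
have cf : {within `[r, +oo[, continuous (fun s : R => n.+1%:R * r ^+ n.+1 * (s^-1) ^+ n.+2)}.
  apply: continuous_in_subspaceT => s; rewrite inE/= in_itv/= andbT => rs.
  have s0 : s != 0 by rewrite gt_eqF// (lt_le_trans r0).
  apply: cvgM; first exact: cvg_cst.
  apply: (@continuous_comp _ _ _ (fun s : R => s^-1) (fun z => z ^+ n.+2)).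
    exact: inv_continuous.
  exact: exprn_continuous.
rewrite (@ge0_continuous_FTC2y _ _ (fun s : R => - (r * s^-1) ^+ n.+1) r 0)//.
- by rewrite divff ?gt_eqF// expr1n EFinN oppeK add0e.
- move=> s rs; have s0 : 0 < s by apply: lt_le_trans rs.
  by apply: mulr_ge0; [apply: mulr_ge0 => //|]; apply: exprn_ge0; rewrite ?invr_ge0 ltW.
- have xV : (x^-1 : R) @[x --> +oo] --> (0 : R).
    by apply/gtr0_cvgV0; [exact: nbhs_pinfty_gt|exact: cvg_id].
  have rxV : (r / x : R) @[x --> +oo] --> (0 : R).
    by rewrite -(mulr0 r); apply: cvgM xV; exact: cvg_cst.
  rewrite -oppr0; apply: cvgN.
  rewrite -[X in _ --> X](_ : 0 ^+ n.+1 = 0); last by rewrite expr0n.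
  exact: (@cvg_comp _ _ _ (fun x : R => r / x) (fun z => z ^+ n.+1) _ _ _ rxV
    (@exprn_continuous R n.+1 0)).
- by move=> s /ltW/dF [].
- apply: cvg_at_right_filter.
  by have [/derivable1_diffP/differentiable_continuous] := dF r (lexx r).
- move=> s; rewrite in_itv/= andbT => /ltW/dF ds.
  by rewrite derive1E; exact: derive_val.
Qed.

Lemma measurable_unit_sphere m : measurable (@unit_sphere R m).
Proof.
rewrite -[X in measurable X]setTI.
exact: (measurable_tnorm measurableT (measurable_set1 1)).
Qed.

Lemma integral_surface_measure m (h : vecT m -> R) :
  measurable_fun setT h -> (forall w, 0 <= h w) ->
  (\int[@surface_measure R m]_(w in @unit_sphere R m) (h w)%:E =
   m%:R%:E * \int[lam m]_y
     (if (0 < tnorm y <= 1)%R then h (tnormalize y) else 0%R)%:E)%E.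
Proof.
move=> mh h0.
have mS := @measurable_unit_sphere m.
have mhE : measurable_fun setT (fun w => (h w)%:E) by exact/measurable_EFinP.
have mB := @measurable_punctured_ball R m.
have mn := @measurable_tnormalize R m.
have mP : measurable (@tnormalize R m @^-1` @unit_sphere R m).
  by rewrite -[X in measurable X]setTI; exact: mn.
rewrite -[LHS]/(\int[pushforward (mscale (NngNum (ler0n R m)) (mrestr (lam m) mB))
  (@tnormalize R m)]_(w in @unit_sphere R m) (h w)%:E)%E.
have mhn : measurable_fun setT (fun y => (h (@tnormalize R m y))%:E).
  exact: measurableT_comp mhE mn.
rewrite ge0_integral_pushforward//; [|exact: measurable_funTS|by move=> w _; rewrite lee_fin].
rewrite ge0_integral_mscale//; [|exact: measurable_funTS|by move=> w _ /=; rewrite lee_fin].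
congr (_ * _)%E.
rewrite ge0_integral_mrestr//; [|exact: measurable_funTS|by move=> w _ /=; rewrite lee_fin].
rewrite integral_mkcond; apply: eq_integral => y _; rewrite patchE.
case: ifPn => [|By]; first by rewrite inE => -[_ /= ->].
(* Every point of the punctured ball normalizes to a unit vector, so restricting to the sphere
   removes nothing. *)
rewrite ifF//; apply/negbTE; apply: contra By => By; rewrite inE; split=> //.
by apply: tnorm_tnormalize; case/andP: By.
Qed.

End SpherePolar.

Ltac solve_ge0 :=
  repeat first [done | exact: ltW | apply: exprn_ge0 | apply: powR_ge0 | apply: tnorm_ge0
    | apply: mulr_ge0].

Section Polar.
Variable R : realType.
Local Notation mu := (@lebesgue_measure R).
Local Notation lam n := (@lebesgue_tuple R n).
Local Notation vecT n := (n.-tuple (measurableTypeR R)).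

(* Insert 1 = int_(s >= |y|) m |y|^m s^(-m-1) ds, exchange the integrals, replace
   y by s y so that y ranges over the ball, exchange back, and replace s by
   s / |y|. *)
Theorem integral_polar n (h : vecT n.+1 -> R) (psi : R -> R) :
  measurable_fun setT h -> (forall w, 0 <= h w) ->
  measurable_fun setT psi -> (forall s, 0 <= psi s) ->
  (\int[lam n.+1]_y (h (tnormalize y) * psi (tnorm y))%:E =
   \int[@surface_measure R n.+1]_(w in @unit_sphere R n.+1) (h w)%:E *
   \int[mu]_s (if (0 < s)%R then s ^+ n * psi s else 0)%:E)%E.
Proof.
move=> mh h0 mpsi psi0.
have mnorm := @measurable_tnorm R n.+1.
have mhn : measurable_fun setT (fun y => h (@tnormalize R n.+1 y)).
  by apply: measurableT_comp => //; exact: measurable_tnormalize.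
have mhpsi : measurable_fun setT
    (fun y : vecT n.+1 => h (tnormalize y) * psi (tnorm y)).
  by apply: measurable_funM => //; exact: measurableT_comp.
(* [F] carries the inserted tail integrand. For s > 0, [H] is [F] at (s, s y) times the Jacobian
   s^(n+1), where |s y| <= s has become |y| <= 1. *)
pose F (p : measurableTypeR R * vecT n.+1) : R :=
  if (0 < tnorm p.2) && (tnorm p.2 <= p.1) then
    n.+1%:R * tnorm p.2 ^+ n.+1 * (p.1 `^ (-1)) ^+ n.+2 *
      (h (tnormalize p.2) * psi (tnorm p.2)) else 0.
pose H (p : measurableTypeR R * vecT n.+1) : R :=
  if (0 < p.1) && (0 < tnorm p.2 <= 1) then
    n.+1%:R * p.1 ^+ n * tnorm p.2 ^+ n.+1 *
      (h (tnormalize p.2) * psi (p.1 * tnorm p.2)) else 0.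
have m1 : measurable_fun setT (fun p : measurableTypeR R * vecT n.+1 => p.1 : R).
  exact: measurable_fst.
have m1V : measurable_fun setT (fun p : measurableTypeR R * vecT n.+1 => p.1 `^ (-1) : R).
  apply: (@measurableT_comp _ _ _ _ _ _ (@powR R ^~ (-1))); last exact: m1.
  exact: measurable_powR.
have m2 : measurable_fun setT (fun p : measurableTypeR R * vecT n.+1 => tnorm p.2).
  exact: (measurableT_comp mnorm measurable_snd).
have mh2 : measurable_fun setT (fun p : measurableTypeR R * vecT n.+1 => h (tnormalize p.2)).
  exact: (measurableT_comp mhn measurable_snd).
have F0 p : (0 <= (F p)%:E)%E.
  rewrite lee_fin /F; case: ifP => // /andP[y0 _].
  by solve_ge0.
have H0 p : (0 <= (H p)%:E)%E.
  rewrite lee_fin /H; case: ifP => // /and3P[s0 y0 _].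
  by solve_ge0.
have mF : measurable_fun setT (fun p => (F p)%:E).
  apply/measurable_EFinP; apply: measurable_fun_ifT => //.
    apply: measurable_and; first exact: measurable_fun_ltr.
    exact: measurable_fun_ler.
  apply: measurable_funM.
    apply: measurable_funM.
      by apply: measurable_funM => //; exact: measurable_funX.
    exact: measurable_funX.
  by apply: measurable_funM => //; exact: measurableT_comp.
have mH : measurable_fun setT (fun p => (H p)%:E).
  apply/measurable_EFinP; apply: measurable_fun_ifT => //.
    apply: measurable_and; first exact: measurable_fun_ltr.
    by apply: measurable_and; [exact: measurable_fun_ltr|exact: measurable_fun_ler].
  apply: measurable_funM.
    apply: measurable_funM; last exact: measurable_funX.
    by apply: measurable_funM => //; exact: measurable_funX.
  apply: measurable_funM => //; apply: (measurableT_comp mpsi).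
  exact: measurable_funM.
transitivity (\int[lam n.+1]_y \int[mu]_s (F (s, y))%:E)%E.
  (* At the origin the inserted factor is 0 instead of 1, so this null set is removed first. *)
  rewrite (@ge0_negligible_integral _ _ _ (lam n.+1) _ [set y | tnorm y = 0])//.
  - rewrite [LHS]integral_mkcond; apply: eq_integral => y _; rewrite patchE.
    have [y0|y0] := eqVneq (tnorm y) 0.
      rewrite memNset; last by case.
      by rewrite integral0_eq// => s _; rewrite /F/= y0 ltxx.
    rewrite mem_set; last by split=> //=; exact/eqP.
    have y_gt0 : 0 < tnorm y by rewrite lt_neqAle eq_sym y0 tnorm_ge0.
    rewrite -[LHS]mul1e -(tail_integral n y_gt0) -ge0_integralZr//.
    + apply: eq_integral => s _; rewrite /F/= y_gt0/= -EFinM.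
      by case: ifP => // _; rewrite mul0r.
    + apply/measurable_EFinP; apply: measurable_fun_ifT => //.
        exact: measurable_fun_ler.
      apply: measurable_funM => //; apply: measurable_funX.
      exact: measurable_powR.
    + move=> s _; rewrite lee_fin; case: ifP => // _.
      by solve_ge0.
    + by rewrite lee_fin mulr_ge0.
  - exact: measurable_tnorm_eq0.
  - exact/measurable_EFinP.
  - by move=> y _; rewrite lee_fin mulr_ge0.
  - exact: lebesgue_tnorm_eq0.
rewrite -(@fubini_tonelli _ _ _ _ _ mu (lam n.+1) _ mF F0).
transitivity (\int[mu]_s \int[lam n.+1]_y (H (s, y))%:E)%E.
  apply: eq_integral => s _; have [s0|s0] := ltP 0 s; last first.
    rewrite !integral0_eq// => y _; first by rewrite /H/= ltNge s0.
    by rewrite /F/=; case: ifP => // /andP[y0 ys]; move: (lt_le_trans y0 ys); rewrite ltNge s0.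
  have mFs : measurable_fun setT (fun y => (F (s, y))%:E).
    exact: (measurableT_comp mF (pair1_measurable s)).
  rewrite -(integral_lebesgue_tscale s0 mFs) //.
  rewrite -ge0_integralZl//; last 2 first.
  - exact: (measurableT_comp mFs (@measurable_tscale R n.+1 s)).
  - by rewrite lee_fin exprn_ge0// ltW.
  apply: eq_integral => y _; rewrite -EFinM; congr EFin.
  rewrite /F /H/= s0 (tnorm_tscale _ (ltW s0)) tnormalize_tscale// pmulr_rgt0//.
  rewrite ger_pMr//=; case: ifP => // _; last by rewrite mulr0.
  (* The Jacobian and |s y|^(n+1) each give s^(n+1); against s^(-n-2) this leaves s^n. *)
  rewrite (powR_inv1 (ltW s0)) exprMn [s^-1 ^+ n.+2]exprSr [s ^+ n.+1 in X in X * _]exprSr.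
  have sE : s ^+ n.+1 * s^-1 ^+ n.+1 = 1 by rewrite -exprMn divff ?gt_eqF// expr1n.
  have s1 : s * s^-1 = 1 by rewrite divff ?gt_eqF.
  rewrite -[RHS]mulr1 -[X in _ = _ * X](mulr1 1) -[X in _ = _ * (X * _)]sE.
  rewrite -[X in _ = _ * (_ * X)]s1; ring.
rewrite (@fubini_tonelli _ _ _ _ _ mu (lam n.+1) _ mH H0).
set G := fun s : R => (if 0 < s then s ^+ n * psi s else 0)%:E.
have mG : measurable_fun setT G.
  apply/measurable_EFinP; apply: measurable_fun_ifT => //.
    exact: measurable_fun_ltr.
  by apply: measurable_funM => //; exact: measurable_funX.
have G0 s : (0 <= G s)%E.
  by rewrite lee_fin; case: ifP => // s0; solve_ge0.
have mB : measurable_fun setT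
    (fun y : vecT n.+1 => (if 0 < tnorm y <= 1 then h (tnormalize y) else 0)%:E).
  apply/measurable_EFinP; apply: measurable_fun_ifT => //.
  by apply: measurable_and; [exact: measurable_fun_ltr|exact: measurable_fun_ler].
rewrite integral_surface_measure// muleAC -ge0_integralZl//; last 2 first.
- by move=> y _; rewrite lee_fin; case: ifP.
- by apply: mule_ge0; [rewrite lee_fin|apply: integral_ge0 => s _; exact: G0].
apply: eq_integral => y _; case: ifPn => [/andP[y0 y1]|By]; last first.
  rewrite mule0 integral0_eq// => s _.
  by rewrite /H/= (negbTE By) andbF.
(* [G] at |y| s contributes |y|^n and the dilation one more |y|, which is the power |y|^(n+1) in
   [H]. *)
rewrite -[in RHS](ge0_integral_scale y0 mG G0) muleA.
rewrite (muleAC _ (\int[mu]_t G (tnorm y * t)%R)%E) -!EFinM -ge0_integralZl//; last 2 first.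
- by apply: (measurableT_comp mG); exact: mulrl_measurable.
- by rewrite lee_fin; solve_ge0.
apply: eq_integral => s _; rewrite /H /G/= y0 y1 -EFinM pmulr_rgt0//; congr EFin.
rewrite !andbT; case: ifP => s0; last by rewrite mulr0.
by rewrite exprMn [tnorm y ^+ n.+1]exprS [s * tnorm y]mulrC; ring.
Qed.

End Polar.

(** * Gaussian integrals *)

Section HalfLineGaussMoments.
Variable R : realType.
Local Notation mu := (@lebesgue_measure R).

Lemma gauss_tail (t : R) : 0 <= t ->
  (\int[mu]_s (if (t <= s)%R then 2 * s * gauss_fun s else 0)%:E)%E = (gauss_fun t)%:E.
Proof.
move=> t0.
transitivity (\int[mu]_(s in `[t, +oo[) (2 * s * gauss_fun s)%:E)%E.
  rewrite [RHS]integral_mkcond; apply: eq_integral => s _; rewrite patchE.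
  by rewrite mem_setE in_itv/= andbT; case: ifPn.
have dF (s : R) : is_derive s 1 (fun s : R => - gauss_fun s) (2 * s * gauss_fun s).
  have D1 : is_derive s 1 (fun s : R => - s ^+ 2) (- (2%:R * s)).
    apply: (is_derive_eq (is_deriveN (is_derive_exprn 2 s))) => /=.
    by rewrite expr1.
  have D2 : is_derive (- s ^+ 2) 1 (fun z : R => - expR z) (- expR (- s ^+ 2)).
    exact: (is_deriveN (is_derive_expR _)).
  have D3 := is_derive1_comp (f := fun z : R => - expR z) (g := fun s : R => - s ^+ 2) D2 D1.
  apply: (is_derive_eq D3); rewrite /gauss_fun; ring.
have cF : continuous (fun s : R => 2 * s * gauss_fun s).
  move=> s; apply: cvgM; last exact: continuous_gauss_fun.
  by apply: cvgM; [exact: cvg_cst|exact: cvg_id].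
rewrite (@ge0_continuous_FTC2y _ _ (fun s : R => - gauss_fun s) t 0)//.
- by rewrite EFinN oppeK add0e.
- move=> s ts; rewrite mulr_ge0 ?gauss_fun_ge0// mulr_ge0//.
  exact: le_trans ts.
- exact: continuous_subspaceT.
- rewrite -oppr0; apply: cvgN; exact: cvg_gauss_fun.
- apply: cvg_at_right_filter.
  by have [/derivable1_diffP/differentiable_continuous] := dF t.
- by move=> s _; rewrite derive1E; have Ds := dF s; exact: derive_val.
Qed.

Lemma integral_exprn k (s : R) : 0 < s ->
  (\int[mu]_t (if (0 < t <= s)%R then t ^+ k else 0)%:E)%E = (s ^+ k.+1 / k.+1%:R)%:E.
Proof.
move=> s0.
have ck : continuous (fun t : R => t ^+ k) by exact: exprn_continuous.
transitivity (\int[mu]_(t in `[0%R, s]) (t ^+ k)%:E)%E.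
  rewrite -integral_itv_obnd_cbnd; last first.
    by apply/measurable_funTS/measurable_EFinP; exact: continuous_measurable_fun.
  rewrite [RHS]integral_mkcond; apply: eq_integral => t _; rewrite patchE.
  by rewrite mem_setE in_itv/=; case: ifPn.
have dF (t : R) : is_derive t 1 (fun t : R => t ^+ k.+1 * k.+1%:R^-1) (t ^+ k).
  have D3 := is_deriveM (is_derive_exprn k.+1 t) (is_derive_cst (k.+1%:R^-1 : R) t 1).
  apply: (is_derive_eq D3); rewrite /= scaler0 add0r /GRing.scale/= mulrA mulVf ?mul1r//.
have cF t : {for t, continuous (fun t : R => t ^+ k.+1 * k.+1%:R^-1)}.
  by have [/derivable1_diffP/differentiable_continuous] := dF t.
rewrite (@continuous_FTC2 _ _ (fun t : R => t ^+ k.+1 * k.+1%:R^-1) 0 s)//.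
- by rewrite expr0n/= mul0r sube0.
- exact: continuous_subspaceT.
- split; first by move=> t _; case: (dF t).
    by apply: cvg_at_right_filter; exact: cF.
  by apply: cvg_at_left_filter; exact: cF.
- by move=> t _; rewrite derive1E; have Ds := dF t; exact: derive_val.
Qed.

(** The integral of s^k e^(-s^2) over s > 0, that is Gamma((k+1)/2) / 2; the recursion is Gamma(a+1)
    = a Gamma(a) at a = (k+1)/2. *)
Fixpoint half_gauss_moment (k : nat) : R :=
  match k with
  | 0 => Num.sqrt pi / 2
  | 1 => 2^-1
  | k'.+2 => k'.+1%:R / 2 * half_gauss_moment k'
  end.

Lemma half_gauss_momentSS k :
  half_gauss_moment k.+2 = k.+1%:R / 2 * half_gauss_moment k.
Proof. by []. Qed.

Lemma half_gauss_moment_gt0 k : 0 < half_gauss_moment k.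
Proof.
suff : 0 < half_gauss_moment k /\ 0 < half_gauss_moment k.+1 by case.
elim: k => [|k [IH1 IH2]].
  by split; rewrite /= ?divr_gt0 ?invr_gt0 ?sqrtr_gt0 ?pi_gt0.
by split=> //; rewrite /= mulr_gt0// divr_gt0.
Qed.

(* Tonelli applied to e^(-t^2) = int_(s >= t) 2 s e^(-s^2) ds replaces an
   integration by parts on an unbounded interval. *)
Lemma integral_half_gauss_rec k :
  (\int[mu]_s (if (0 < s)%R then s ^+ k.+2 * gauss_fun s else 0)%:E =
   (k.+1%:R / 2)%:E * \int[mu]_s (if (0 < s)%R then s ^+ k * gauss_fun s else 0)%:E)%E.
Proof.
pose F (p : measurableTypeR R * measurableTypeR R) : R :=
  if 0 < p.1 <= p.2 then k.+1%:R / 2 * p.1 ^+ k * (2 * p.2 * gauss_fun p.2) else 0.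
have m1 : measurable_fun setT (fun p : measurableTypeR R * measurableTypeR R => p.1 : R).
  exact: measurable_fst.
have m2 : measurable_fun setT (fun p : measurableTypeR R * measurableTypeR R => p.2 : R).
  exact: measurable_snd.
have mg := @measurable_gauss_fun R.
have F0 p : (0 <= (F p)%:E)%E.
  rewrite lee_fin /F; case: ifP => // /andP[p0 /(lt_le_trans p0) p2].
  by rewrite mulr_ge0 ?mulr_ge0 ?gauss_fun_ge0 ?exprn_ge0 ?invr_ge0 ?(ltW p0) ?(ltW p2).
have mF : measurable_fun setT (fun p => (F p)%:E).
  apply/measurable_EFinP; apply: measurable_fun_ifT => //.
    apply: measurable_and; first exact: measurable_fun_ltr.
    exact: measurable_fun_ler.
  apply: measurable_funM.
    by apply: measurable_funM => //; exact: measurable_funX.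
  apply: measurable_funM; first exact: measurable_funM.
  exact: (measurableT_comp mg m2).
(* Integrating over [t] first turns t^k into s^(k+1)/(k+1) and restores s^(k+2) e^(-s^2);
   integrating over [s] first gives the tail e^(-t^2). *)
transitivity (\int[mu]_s \int[mu]_t (F (t, s))%:E)%E.
  apply: eq_integral => s _; case: ifPn => s0; last first.
    rewrite integral0_eq// => t _; rewrite /F/=; case: ifP => // /andP[t0 ts].
    by rewrite (lt_le_trans t0 ts) in s0.
  transitivity (\int[mu]_t ((k.+1%:R / 2 * (2 * s * gauss_fun s))%:E *
      (if (0 < t <= s)%R then t ^+ k else 0)%:E))%E; last first.
    apply: eq_integral => t _; rewrite -EFinM /F/=; case: ifP => _; last by rewrite mulr0.
    by congr EFin; ring.
  rewrite ge0_integralZl//.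
  - rewrite integral_exprn// -EFinM; congr EFin.
    rewrite [s ^+ k.+2]exprS; field.
    by rewrite nat1r pnatr_eq0.
  - apply/measurable_EFinP; apply: measurable_fun_ifT => //.
    by apply: measurable_and; [exact: measurable_fun_ltr|exact: measurable_fun_ler].
  - by move=> t _; rewrite lee_fin; case: ifP => // /andP[t0 _]; rewrite exprn_ge0// ltW.
  - by rewrite lee_fin !mulr_ge0 ?gauss_fun_ge0 ?invr_ge0 ?(ltW s0).
rewrite -(@fubini_tonelli _ _ _ _ _ mu mu _ mF F0) -ge0_integralZl//; last 2 first.
- apply/measurable_EFinP; apply: measurable_fun_ifT => //; first exact: measurable_fun_ltr.
  by apply: measurable_funM => //; exact: measurable_funX.
- move=> s _; rewrite lee_fin; case: ifP => // s0.
  by rewrite mulr_ge0 ?gauss_fun_ge0// exprn_ge0// ltW.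
apply: eq_integral => t _; case: ifPn => t0; last first.
  by rewrite mule0 integral0_eq// => s _; rewrite /F/= (negbTE t0).
rewrite [X in (_ * X)%E]EFinM -(gauss_tail (ltW t0)) muleA -ge0_integralZl//.
- apply: eq_integral => s _; rewrite /F/= t0/= -!EFinM; congr EFin.
  by case: ifP => // _; rewrite mulr0.
- apply/measurable_EFinP; apply: measurable_fun_ifT => //; first exact: measurable_fun_ler.
  by apply: measurable_funM => //; exact: measurable_funM.
- move=> s _; rewrite lee_fin; case: ifP => // ts.
  by rewrite !mulr_ge0 ?gauss_fun_ge0// (le_trans (ltW t0) ts).
- by rewrite -EFinM lee_fin !mulr_ge0 ?exprn_ge0 ?invr_ge0 ?(ltW t0).
Qed.

Lemma integral_half_gauss k :
  (\int[mu]_s (if (0 < s)%R then s ^+ k * gauss_fun s else 0)%:E)%E =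
  (half_gauss_moment k)%:E.
Proof.
suff : (\int[mu]_s (if (0 < s)%R then s ^+ k * gauss_fun s else 0)%:E)%E =
    (half_gauss_moment k)%:E /\
  (\int[mu]_s (if (0 < s)%R then s ^+ k.+1 * gauss_fun s else 0)%:E)%E =
    (half_gauss_moment k.+1)%:E by case.
elim: k => [|k [IH1 IH2]]; last first.
  by split=> //; rewrite integral_half_gauss_rec IH1 -EFinM.
split.
  rewrite -[RHS]integral0y_gauss -integral_itv_obnd_cbnd; last first.
    by apply/measurable_funTS/measurable_EFinP; exact: measurable_gauss_fun.
  rewrite [RHS]integral_mkcond; apply: eq_integral => t _; rewrite patchE.
  by rewrite mem_setE in_itv/= andbT expr0 mul1r; case: ifPn.
(* The first moment is half the tail integral from 0. The conditions 0 < s and 0 <= s differ only at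
   0, where the integrand vanishes. *)
have := gauss_tail (lexx 0).
rewrite /gauss_fun expr0n/= oppr0 expR0 => e.
have -> : (2^-1 : R)%:E = (2^-1%:E * 1%:E)%E by rewrite -EFinM mulr1.
rewrite -e -ge0_integralZl//.
- apply: eq_integral => s _; rewrite -EFinM expr1; congr EFin.
  have [s0|s0|<-] := ltgtP 0 s; rewrite ?mulr0 ?mul0r ?mulr0//.
  by rewrite !mulrA mulVf ?mul1r// pnatr_eq0.
- apply/measurable_EFinP; apply: measurable_fun_ifT => //; first exact: measurable_fun_ler.
  by apply: measurable_funM; [exact: measurable_funM|exact: measurable_gauss_fun].
- by move=> s _; rewrite lee_fin; case: ifP => // s0; rewrite !mulr_ge0 ?expR_ge0.
Qed.

End HalfLineGaussMoments.

(** * The Gamma function at half-integers *)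

Section GammaHalfInteger.
Variable R : realType.
Local Notation mu := (@lebesgue_measure R).

Lemma cvgry_sqrt : Num.sqrt x @[x --> +oo%R] --> (+oo%R : set_system R).
Proof.
apply/cvgryPge => M; near=> x.
have Mx : M ^+ 2 <= x by near: x; apply: nbhs_pinfty_ge; exact: num_real.
rewrite (le_trans (ler_norm M))// -sqrtr_sqr ler_sqrt//.
Unshelve. all: by end_near. Qed.

Lemma derive1_sqrt (x : R) : 0 < x -> derive1 (@Num.sqrt R) x = (2 * Num.sqrt x)^-1.
Proof. by move=> x0; rewrite derive1E derive_sqrt. Qed.

Lemma continuous_derive1_sqrt (x : R) : 0 < x -> {for x, continuous (derive1 (@Num.sqrt R))}.
Proof.
move=> x0; rewrite /prop_for /continuous_at derive1_sqrt//.
have h : (2 * Num.sqrt y)^-1 @[y --> x] --> (2 * Num.sqrt x)^-1.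
  apply: cvgV; first by rewrite mulf_neq0// gt_eqF// sqrtr_gt0.
  by apply: cvgM; [exact: cvg_cst|exact: sqrt_continuous].
apply: cvg_trans h; apply: near_eq_cvg; near=> y; rewrite derive1_sqrt//.
by near: y; exact: lt_nbhsr.
Unshelve. all: by end_near. Qed.

Lemma cvg_derive1_sqrt : derive1 (@Num.sqrt R) x @[x --> +oo%R] --> (0 : R).
Proof.
have h : (2 * Num.sqrt y)^-1 @[y --> +oo%R] --> (0 : R).
  under eq_fun do rewrite invfM.
  rewrite -(mulr0 (2^-1)); apply: cvgM; first exact: cvg_cst.
  apply/gtr0_cvgV0; last exact: cvgry_sqrt.
  near=> x; rewrite sqrtr_gt0; near: x; exact: nbhs_pinfty_gt.
apply: cvg_trans h; apply: near_eq_cvg; near=> y; rewrite derive1_sqrt//.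
Unshelve. all: by end_near. Qed.

(* Away from 0, because the derivative of the square root is unbounded there. *)
Lemma gauss_substitution_sqrt k (a : R) : 0 < a ->
  (\int[mu]_(s in `[a, +oo[) (2 * (s ^+ k * gauss_fun s))%:E =
   \int[mu]_(t in `[(a ^+ 2)%R, +oo[) (t `^ (k.+1%:R / 2 - 1) * expR (- t))%:E)%E.
Proof.
move=> a0; have a20 : 0 < a ^+ 2 by rewrite exprn_gt0.
have sa : Num.sqrt (a ^+ 2) = a by rewrite sqrtr_sqr gtr0_norm.
have cG : continuous (fun s : R => 2 * (s ^+ k * gauss_fun s)).
  move=> s; apply: cvgM; first exact: cvg_cst.
  by apply: cvgM; [exact: exprn_continuous|exact: continuous_gauss_fun].
rewrite -[in LHS]sa increasing_ge0_integration_by_substitutiony.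
- apply: eq_integral => t; rewrite inE/= in_itv/= andbT => at_.
  have t0 : 0 < t by exact: lt_le_trans at_.
  congr EFin; rewrite !fctE/= derive1_sqrt// /gauss_fun sqr_sqrtr ?ltW//.
  have -> : t `^ (k.+1%:R / 2 - 1) = Num.sqrt t ^+ k / Num.sqrt t.
    rewrite -powR12_sqrt ?ltW// -powR_mulrn ?powR_ge0// -powRrM -powRN -powRD.
      by congr (_ `^ _); rewrite -natr1; field.
    by rewrite (gt_eqF t0) implybT.
  by rewrite invfM; field; rewrite gt_eqF// sqrtr_gt0.
- move=> x y; rewrite !in_itv/= !andbT => ax ay xy.
  by rewrite ltr_sqrt// (le_lt_trans _ xy)// (le_trans (ltW a20)).
- move=> x; rewrite in_itv/= andbT => ax; apply: continuous_derive1_sqrt.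
  exact: lt_trans ax.
- apply/cvg_ex; exists (derive1 (@Num.sqrt R) (a ^+ 2)).
  by apply: cvg_at_right_filter; exact: continuous_derive1_sqrt.
- by apply/cvg_ex; exists 0; exact: cvg_derive1_sqrt.
- split; last by apply: cvg_at_right_filter; exact: sqrt_continuous.
  move=> x; rewrite in_itv/= andbT => ax.
  by have [] := is_derive1_sqrt (lt_trans a20 ax).
- exact: cvgry_sqrt.
- exact: continuous_subspaceT.
- move=> s; rewrite sa in_itv/= andbT => /(lt_trans a0)/ltW s0.
  by rewrite mulr_ge0// mulr_ge0 ?gauss_fun_ge0 ?exprn_ge0.
Qed.

(** Monotone convergence on growing half-lines; it removes the positive cutoff under which the
    substitution by the square root is made. *)
Lemma cvg_integral_itv_pos (u : R^nat) (g : R -> \bar R) :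
  (forall n, 0 < u n) -> nonincreasing_seq u -> u @ \oo --> 0 ->
  measurable_fun setT g -> (forall t, 0 < t -> (0 <= g t)%E) ->
  (\int[mu]_(t in `[u n, +oo[) g t @[n --> \oo] --> \int[mu]_(t in `]0%R, +oo[) g t)%E.
Proof.
move=> u0 ndu cu mg g0.
rewrite (_ : `]0%R, +oo[%classic = \bigcup_n `[u n, +oo[%classic).
  apply: ge0_nondecreasing_set_cvg_integral => //.
  - move=> i j ij; apply/subsetPset => t /=; rewrite !in_itv/= !andbT.
    by apply: le_trans; exact: ndu.
  - by move=> i; exact: measurable_funTS.
  - move=> i t; rewrite /= in_itv/= andbT => ut; apply: g0.
    exact: lt_le_trans ut.
apply/seteqP; split => t /=.
  rewrite in_itv/= andbT => t0.
  have [n _ /(_ n (leqnn n))/ltW un] : \forall n \near \oo, u n < t by exact: cvgr_lt cu _ t0.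
  by exists n => //=; rewrite in_itv/= un.
by move=> [n _]; rewrite /= !in_itv/= !andbT; exact: lt_le_trans.
Qed.

(** Substitute t = s^2. A cutoff [u n] in s becomes its square in t, and both sequences decrease to
    0, so the two truncated integrals have the two sides as limits. *)
Lemma GammaE k : Gamma (k.+1%:R / 2 : R) = 2 * half_gauss_moment R k.
Proof.
pose u n : R := n.+1%:R^-1.
have u0 n : 0 < u n by rewrite invr_gt0.
have ndu : nonincreasing_seq u.
  by move=> i j ij; rewrite lef_pV2 ?posrE// ler_nat ltnS.
have cu : u @ \oo --> 0 by exact: cvg_harmonic.
have cu2 : (u n ^+ 2) @[n --> \oo] --> (0 : R).
  by rewrite -[X in _ --> X](mulr0 0); under eq_fun do rewrite expr2; exact: cvgM.
have mg1 : measurable_fun setT (fun s : R => (2 * (s ^+ k * gauss_fun s))%:E).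
  apply/measurable_EFinP; apply: measurable_funM => //.
  by apply: measurable_funM => //; exact: measurable_gauss_fun.
have mg2 : measurable_fun setT (fun t : R => (t `^ (k.+1%:R / 2 - 1) * expR (- t))%:E).
  apply/measurable_EFinP; apply: measurable_funM; first exact: measurable_powR.
  by apply: measurableT_comp => //; exact: measurable_expR.
have c1 := cvg_integral_itv_pos u0 ndu cu mg1.
have c2 : (\int[mu]_(t in `[(u n ^+ 2)%R, +oo[) (t `^ (k.+1%:R / 2 - 1) * expR (- t))%:E
    @[n --> \oo] -->
    \int[mu]_(t in `]0%R, +oo[) (t `^ (k.+1%:R / 2 - 1) * expR (- t))%:E)%E.
  apply: (@cvg_integral_itv_pos (fun n => u n ^+ 2) _ _ _ cu2 mg2).
  - by move=> n; rewrite exprn_gt0.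
  - move=> i j ij; rewrite ler_pXn2r ?nnegrE ?(ltW (u0 _))//; exact: ndu.
  - by move=> t _; rewrite lee_fin mulr_ge0 ?powR_ge0 ?expR_ge0.
rewrite /Gamma /Rintegral -[RHS]/(fine (2 * half_gauss_moment R k)%:E); congr fine.
rewrite EFinM -integral_half_gauss -ge0_integralZl//.
- transitivity (\int[mu]_(s in `]0%R, +oo[) (2 * (s ^+ k * gauss_fun s))%:E)%E.
    have c3 : (\int[mu]_(t in `[(u n ^+ 2)%R, +oo[) (t `^ (k.+1%:R / 2 - 1) * expR (- t))%:E
        @[n --> \oo] --> \int[mu]_(s in `]0%R, +oo[) (2 * (s ^+ k * gauss_fun s))%:E)%E.
      under eq_fun => n do rewrite -(gauss_substitution_sqrt k (u0 n)).
      apply: c1 => t t0; rewrite lee_fin mulr_ge0// mulr_ge0 ?gauss_fun_ge0//.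
      by rewrite exprn_ge0// ltW.
    exact: (cvg_unique _ c2 c3).
  rewrite [LHS]integral_mkcond; apply: eq_integral => s _; rewrite patchE.
  rewrite mem_setE in_itv/= andbT -EFinM; case: ifPn => // _.
  by rewrite mulr0.
- apply/measurable_EFinP; apply: measurable_fun_ifT => //; first exact: measurable_fun_ltr.
  by apply: measurable_funM => //; exact: measurable_gauss_fun.
- move=> s _; rewrite lee_fin; case: ifP => // s0.
  by rewrite mulr_ge0 ?gauss_fun_ge0// exprn_ge0// ltW.
Qed.

End GammaHalfInteger.

(** * Moments of the Gaussian weight on R^m *)

Lemma even_expr_ge0 (R : realDomainType) (x : R) k : 0 <= x ^+ (2 * k).
Proof. by rewrite exprM exprn_ge0// sqr_ge0. Qed.

Lemma sum_even (V : nmodType) (F : nat -> V) j : (forall k, odd k -> F k = 0) ->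
  \sum_(k < (2 * j).+1) F k = \sum_(i < j.+1) F (2 * i)%N.
Proof.
move=> F0; elim: j => [|j IH]; first by rewrite muln0 !big_ord1.
rewrite big_ord_recr [RHS]big_ord_recr/= -IH; congr (_ + _).
by rewrite mulnS big_ord_recr/= F0 ?addr0//= oddM.
Qed.

Lemma exprD_sym (A : comNzRingType) (a b : A) j :
  (a + b) ^+ (2 * j) + (- a + b) ^+ (2 * j) =
  2 * \sum_(i < j.+1) 'C(2 * j, 2 * i)%:R * a ^+ (2 * i) * b ^+ (2 * (j - i)).
Proof.
rewrite ![_ + b]addrC !exprDn -big_split/=.
pose F k := b ^+ (2 * j - k) * a ^+ k *+ 'C(2 * j, k) +
  b ^+ (2 * j - k) * (- a) ^+ k *+ 'C(2 * j, k).
transitivity (\sum_(k < (2 * j).+1) F k); first by [].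
rewrite sum_even => [|k ok].
  rewrite mulr_sumr; apply: eq_bigr => i _.
  rewrite /F [(- a) ^+ _]exprM sqrrN -exprM -mulnBr.
  by move: (b ^+ _) (a ^+ _) ('C(_, _)) => p q c; rewrite -[p * q *+ c]mulr_natr; ring.
by rewrite /F exprNn -signr_odd ok expr1 mulN1r mulrN mulNrn subrr.
Qed.

Section GaussianMoments.
Variable R : realType.
Local Notation mu := (@lebesgue_measure R).
Local Notation lam n := (@lebesgue_tuple R n).
Local Notation vecT n := (n.-tuple (measurableTypeR R)).

(* The moment of order 2j of e^(-t^2), divided by sqrt pi. *)
Definition gauss_coef (j : nat) : R := (2 * j)`!%:R / (4 ^+ j * j`!%:R).

Lemma gauss_coef_gt0 j : 0 < gauss_coef j.
Proof. by rewrite divr_gt0 ?mulr_gt0 ?exprn_gt0 ?ltr0n ?fact_gt0. Qed.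

Lemma gauss_coef_ge0 j : 0 <= gauss_coef j.
Proof. exact/ltW/gauss_coef_gt0. Qed.

Lemma gauss_coefS j : gauss_coef j.+1 = (2 * j).+1%:R / 2 * gauss_coef j.
Proof.
rewrite /gauss_coef (_ : (2 * j.+1 = (2 * j).+2)%N); last by rewrite mulnS.
rewrite [(2 * j).+2`!]factS [(2 * j).+1`!]factS [j.+1`!]factS exprS !natrM.
have -> : (2 * j).+2%:R = 2 * j.+1%:R :> R by rewrite -natrM mulnS.
have j0 : j.+1%:R != 0 :> R by rewrite pnatr_eq0.
have jf0 : j`!%:R != 0 :> R by rewrite pnatr_eq0 -lt0n fact_gt0.
have p0 : 4 ^+ j != 0 :> R by rewrite expf_neq0// pnatr_eq0.
move: (j.+1%:R : R) j0 (j`!%:R : R) jf0 (4 ^+ j : R) p0 => x x0 y y0 z z0.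
by field; rewrite x0 y0 z0.
Qed.

Lemma half_gauss_moment_even j :
  2 * half_gauss_moment R (2 * j) = Num.sqrt pi * gauss_coef j.
Proof.
elim: j => [|j IH].
  by rewrite /gauss_coef !muln0 expr0 !fact0 mulr1 divr1 mulr1/= mulrC divfK.
rewrite gauss_coefS mulrCA -IH (_ : (2 * j.+1 = (2 * j).+2)%N); last by rewrite mulnS.
by rewrite half_gauss_momentSS mulrCA.
Qed.

Lemma integral_gauss_moment_even j :
  (\int[mu]_t (t ^+ (2 * j) * gauss_fun t)%:E)%E = (Num.sqrt pi * gauss_coef j)%:E.
Proof.
have mf : measurable_fun setT (fun t : R => t ^+ (2 * j) * gauss_fun t).
  by apply: measurable_funM => //; exact: measurable_gauss_fun.
have f0 (t : R) : 0 <= t ^+ (2 * j) * gauss_fun t.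
  by rewrite mulr_ge0 ?gauss_fun_ge0 ?even_expr_ge0.
rewrite ge0_symfun_integralT//.
- rewrite -half_gauss_moment_even EFinM -integral_half_gauss; congr (_ * _)%E.
  have -> : [set t : R | 0 <= t] = `[0, +oo[%classic.
    by apply/seteqP; split=> t; rewrite /= in_itv/= andbT.
  rewrite -integral_itv_obnd_cbnd; last by apply: measurable_funTS; exact/measurable_EFinP.
  rewrite [LHS]integral_mkcond; apply: eq_integral => s _; rewrite patchE.
  by rewrite mem_setE in_itv/= andbT; case: ifPn.
- move=> t; apply: cvgM; [exact: exprn_continuous|exact: continuous_gauss_fun].
- by move=> t; rewrite /= /gauss_fun sqrrN [(- t) ^+ _]exprM sqrrN -exprM.
Qed.

(* Averaging over t and - t removes the odd powers of t, so that only nonnegative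
   functions are integrated. *)
Lemma integral_gauss_affine (a b : R) j :
  (\int[mu]_t ((a * t + b) ^+ (2 * j) * gauss_fun t)%:E)%E =
  (\sum_(i < j.+1) 'C(2 * j, 2 * i)%:R * a ^+ (2 * i) * b ^+ (2 * (j - i)) *
     (Num.sqrt pi * gauss_coef i))%:E.
Proof.
pose f (t : R) : \bar R := ((a * t + b) ^+ (2 * j) * gauss_fun t)%:E.
have even_ge0 := @even_expr_ge0 R.
have mf : measurable_fun setT f.
  apply/measurable_EFinP; apply: measurable_funM; last exact: measurable_gauss_fun.
  by apply: measurable_funX; apply: measurable_funD => //; exact: measurable_funM.
have f0 t : (0 <= f t)%E by rewrite lee_fin mulr_ge0 ?gauss_fun_ge0.
have mfN : measurable_fun setT (fun t : R => f (- t)).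
  by apply: (measurableT_comp mf); exact: oppr_measurable.
rewrite -[LHS]/(\int[mu]_t f t)%E.
(* Twice the integral is the integral of the symmetrized function. Doubling can be undone in the
   extended reals before the integral is known to be finite. *)
have two_inj : injective (fun x : \bar R => 2%:E * x)%E.
  by move=> x y /=; apply: (can_inj (g := fun z => 2^-1%:E * z)%E) => z;
    rewrite muleA -EFinM mulVf// mul1e.
apply: two_inj; rewrite -EFinM mule_natl mule2n -[X in (_ + X)%E]ge0_integral_opp//.
rewrite -ge0_integralD//.
under eq_integral => t _.
  rewrite /f -EFinD mulrN -/(gauss_fun _).
  rewrite {2}/gauss_fun sqrrN -/(gauss_fun _) -mulrDl exprD_sym.
  rewrite mulr_sumr mulr_suml -sumEFin.
  over.
rewrite ge0_integral_sum//.
- rewrite mulr_sumr -sumEFin; apply: eq_bigr => i _.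
  pose K := 2 * ('C(2 * j, 2 * i)%:R * a ^+ (2 * i) * b ^+ (2 * (j - i))).
  rewrite mulrA -/K EFinM -integral_gauss_moment_even -ge0_integralZl//.
  + apply: eq_integral => t _; rewrite -EFinM exprMn; congr EFin.
    by rewrite /K; move: (a ^+ _) (b ^+ _) => p q; ring.
  + apply/measurable_EFinP; apply: measurable_funM; last exact: measurable_gauss_fun.
    exact: measurable_funX.
  + by move=> t _; rewrite lee_fin mulr_ge0 ?gauss_fun_ge0.
  + by rewrite lee_fin /K; apply: mulr_ge0 => //; apply: mulr_ge0 => //; apply: mulr_ge0.
- move=> i; apply/measurable_EFinP; apply: measurable_funM; last exact: measurable_gauss_fun.
  apply: measurable_funM => //; apply: measurable_funM => //; apply: measurable_funM => //.
  by apply: measurable_funX; exact: measurable_funM.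
- move=> i t _; rewrite lee_fin; apply: mulr_ge0; last exact: gauss_fun_ge0.
  by apply: mulr_ge0 => //; apply: mulr_ge0 => //; apply: mulr_ge0.
Qed.

(** The even factorials cancel against the binomial coefficient and the powers of 4 multiply up. In
    [integral_gauss_dot] this turns the moments of an affine function into the binomial expansion of
    a power of a sum of squares. *)
Lemma bin_gauss_coef i j : (i <= j)%N ->
  'C(2 * j, 2 * i)%:R * gauss_coef i * gauss_coef (j - i) = 'C(j, i)%:R * gauss_coef j.
Proof.
move=> ij; rewrite /gauss_coef.
have f0 k : k`!%:R != 0 :> R by rewrite pnatr_eq0 -lt0n fact_gt0.
have p0 k : 4 ^+ k != 0 :> R by rewrite expf_neq0// pnatr_eq0.
have e1 : 'C(j, i)%:R * i`!%:R * (j - i)`!%:R = j`!%:R :> R.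
  by rewrite -!natrM -mulnA bin_fact.
have e2 : 'C(2 * j, 2 * i)%:R * (2 * i)`!%:R * (2 * (j - i))`!%:R = (2 * j)`!%:R :> R.
  by rewrite -!natrM -mulnA mulnBr bin_fact// leq_pmul2l.
have e3 : 4 ^+ j = 4 ^+ i * 4 ^+ (j - i) :> R by rewrite -exprD subnKC.
have c0 : 'C(j, i)%:R != 0 :> R by rewrite pnatr_eq0 -lt0n bin_gt0.
rewrite -e2 -e1 e3; field.
by rewrite !p0 !f0 c0.
Qed.

Definition dot n (v : 'I_n -> R) (y : vecT n) : R := \sum_i v i * tnth y i.

Lemma measurable_dot n (v : 'I_n -> R) : measurable_fun setT (dot v).
Proof.
apply: measurable_sum => i.
by apply: measurable_funM; [exact: measurable_cst|exact: measurable_coord].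
Qed.

Lemma dot_tcons n (v : 'I_n.+1 -> R) t (y : vecT n) :
  dot v (tcons (t, y)) = v ord0 * t + dot (v \o lift ord0) y.
Proof.
rewrite /dot big_ord_recl tnth0/=; congr (_ + _).
by apply: eq_bigr => i _; rewrite tnthS.
Qed.

Lemma gauss_tnorm_tcons n t (y : vecT n) :
  gauss_fun (tnorm (tcons (t, y))) = gauss_fun t * gauss_fun (tnorm y).
Proof.
rewrite /gauss_fun !sqr_tnorm big_ord_recl tnth0/= opprD expRD; congr (_ * expR (- _)).
by apply: eq_bigr => i _; rewrite tnthS.
Qed.

(** Reducing to a multiple of one basis vector would need rotation invariance of Lebesgue measure.
    Since the weight is a product over the coordinates, they can be integrated out one at a time
    with Tonelli instead. *)
Theorem integral_gauss_dot n (v : 'I_n -> R) j :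
  (\int[lam n]_y (dot v y ^+ (2 * j) * gauss_fun (tnorm y))%:E)%E =
  (Num.sqrt pi ^+ n * gauss_coef j * (\sum_i v i ^+ 2) ^+ j)%:E.
Proof.
have even_ge0 := @even_expr_ge0 R.
have mgn k : measurable_fun setT (fun y : vecT k => gauss_fun (tnorm y)).
  apply: measurableT_comp; [exact: measurable_gauss_fun|exact: measurable_tnorm].
have mF : forall k (u : 'I_k -> R) l,
    measurable_fun setT (fun y : vecT k => (dot u y ^+ (2 * l) * gauss_fun (tnorm y))%:E).
  move=> k u l; apply/measurable_EFinP; apply: measurable_funM; last exact: mgn.
  by apply: measurable_funX; exact: measurable_dot.
have F0 : forall k (u : 'I_k -> R) l (y : vecT k),
    (0 <= (dot u y ^+ (2 * l) * gauss_fun (tnorm y))%:E)%E.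
  by move=> k u l y; rewrite lee_fin mulr_ge0 ?gauss_fun_ge0.
elim: n v j => [|n IH] v j.
  rewrite [LHS](integral_dirac _ measurableT (mF _ v j)) diracT mul1e.
  rewrite /dot /gauss_fun sqr_tnorm !big_ord0 oppr0 expR0 mulr1 expr0 mul1r.
  (* In dimension 0 both sides are 1 for [j = 0] and 0 otherwise. *)
  case: j => [|j]; first by rewrite muln0 !expr0 /gauss_coef muln0 !fact0 expr0 !mulr1 divr1.
  by rewrite !expr0n/= mulr0.
rewrite integral_lebesgue_tcons//.
pose P (p : measurableTypeR R * vecT n) :=
  (dot v (tcons p) ^+ (2 * j) * gauss_fun (tnorm (tcons p)))%:E.
have mP : measurable_fun setT P.
  by apply: (measurableT_comp (mF _ v j)); exact: measurable_tcons.
have P0 p : (0 <= P p)%E by exact: F0.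
rewrite -[LHS]/(\int[mu]_t \int[lam n]_y P (t, y))%E.
(* With [y] fixed the linear form is affine in the first coordinate [t], so [t] has to be integrated
   first. *)
rewrite (@fubini_tonelli _ _ _ _ _ mu (lam n) _ mP P0).
pose v' := v \o lift ord0.
pose K i : R := 'C(2 * j, 2 * i)%:R * v ord0 ^+ (2 * i) * (Num.sqrt pi * gauss_coef i).
have K0 i : 0 <= K i by rewrite !mulr_ge0 ?gauss_coef_ge0 ?sqrtr_ge0.
transitivity (\int[lam n]_y \sum_(i < j.+1)
   ((K i)%:E * (dot v' y ^+ (2 * (j - i)) * gauss_fun (tnorm y))%:E))%E.
  apply: eq_integral => y _; rewrite /P.
  under eq_integral do rewrite dot_tcons gauss_tnorm_tcons mulrA EFinM.
  rewrite ge0_integralZr//.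
  - rewrite integral_gauss_affine -EFinM mulr_suml -sumEFin.
    apply: eq_bigr => i _; rewrite -EFinM; congr EFin; rewrite /K /v'.
    by move: (v ord0 ^+ _) (dot _ _ ^+ _) => p q; ring.
  - apply/measurable_EFinP; apply: measurable_funM; last exact: measurable_gauss_fun.
    by apply: measurable_funX; apply: measurable_funD => //; exact: measurable_funM.
  - by move=> t _; rewrite lee_fin mulr_ge0 ?gauss_fun_ge0.
  - by rewrite lee_fin gauss_fun_ge0.
rewrite ge0_integral_sum//.
- have -> : \sum_i v i ^+ 2 = \sum_i v' i ^+ 2 + v ord0 ^+ 2.
    by rewrite big_ord_recl addrC.
  rewrite exprDn mulr_sumr -sumEFin; apply: eq_bigr => i _.
  rewrite ge0_integralZl//; [|exact: mF|by rewrite lee_fin].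
  rewrite IH -EFinM; congr EFin.
  have ij : (i <= j)%N by rewrite -ltnS.
  rewrite /K exprM -[_ *+ 'C(j, i)]mulr_natr [Num.sqrt pi ^+ n.+1]exprS.
  move: (bin_gauss_coef ij) (_ ^+ i) (_ ^+ (j - i)) (Num.sqrt pi ^+ n) => e p q r.
  transitivity (Num.sqrt pi * r *
    ('C(2 * j, 2 * i)%:R * gauss_coef i * gauss_coef (j - i)) * p * q).
    by ring.
  by rewrite e; ring.
- by move=> i; apply: measurable_funeM; exact: mF.
- by move=> i y _; apply: mule_ge0 => //; rewrite lee_fin.
Qed.

End GaussianMoments.

(** * Moments of the surface measure *)

(** A nonzero difference would have all naturals below its size as roots, which is one too many. *)
Lemma poly_eq_horner (A : numDomainType) (p q : {poly A}) :
  (forall s, p.[s] = q.[s]) -> p = q.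
Proof.
move=> pq; apply/eqP; rewrite -subr_eq0; apply/negP => /negP r0.
have := max_poly_roots r0 (rs := [seq i%:R | i <- iota 0 (size (p - q)%R)]).
rewrite size_map size_iota ltnn => H; suff : false by []; apply: H.
  by apply/allP => s _; rewrite rootE hornerD hornerN pq subrr.
by rewrite map_inj_uniq ?iota_uniq// => i j /eqP; rewrite eqr_nat => /eqP.
Qed.

Section SphereMoments.
Variable R : realType.
Variable n : nat.
Local Notation m := n.+1.
Local Notation vecT := (m.-tuple (measurableTypeR R)).
Local Notation sigma := (@surface_measure R m).
Local Notation S := (@unit_sphere R m).

(** At the origin both sides are 0, so the factorization into direction and length holds without
    exception. *)
Lemma tnormalize_scale (y : vecT) i : tnth (tnormalize y) i * tnorm y = tnth y i.
Proof.
rewrite tnth_mktuple; have [y0|y0] := eqVneq (tnorm y) 0; last by rewrite divfK.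
by rewrite y0 mulr0 tnorm_eq0.
Qed.

Lemma dot_tnormalize (v : 'I_m -> R) (y : vecT) : dot v (tnormalize y) * tnorm y = dot v y.
Proof.
by rewrite /dot mulr_suml; apply: eq_bigr => i _; rewrite -mulrA tnormalize_scale.
Qed.

(** The Gaussian moment pi^(m/2) [gauss_coef j] divided by the radial integral Gamma(m/2 + j) /
    2. *)
Definition sphere_moment (j : nat) : R :=
  2 * Num.sqrt pi ^+ m * gauss_coef R j / Gamma (m%:R / 2 + j%:R).

Lemma Gamma_shift j : Gamma (m%:R / 2 + j%:R : R) = 2 * half_gauss_moment R (n + 2 * j).
Proof.
rewrite -GammaE; congr Gamma.
have -> : (n + 2 * j).+1%:R = m%:R + 2 * j%:R :> R by rewrite -addSn natrD natrM.
by field.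
Qed.

Lemma Gamma_shift_gt0 j : 0 < Gamma (m%:R / 2 + j%:R : R).
Proof. by rewrite Gamma_shift mulr_gt0// half_gauss_moment_gt0. Qed.

Lemma ereal_sphere_integral_even (v : 'I_m -> R) j :
  (\int[sigma]_(w in S) (dot v w ^+ (2 * j))%:E)%E =
  (sphere_moment j * (\sum_i v i ^+ 2) ^+ j)%:E.
Proof.
set I := (\int[sigma]_(w in S) _)%E.
have h0 := half_gauss_moment_gt0 R (n + 2 * j).
have e : (I * (half_gauss_moment R (n + 2 * j))%:E)%E =
    (Num.sqrt pi ^+ m * gauss_coef R j * (\sum_i v i ^+ 2) ^+ j)%:E.
  rewrite -integral_gauss_dot -integral_half_gauss.
  have -> : (\int[lebesgue_measure]_s
      (if (0 < s)%R then s ^+ (n + 2 * j) * gauss_fun s else 0)%:E)%E =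
    (\int[@lebesgue_measure R]_s
      (if (0 < s)%R then s ^+ n * (s ^+ (2 * j) * gauss_fun s) else 0)%:E)%E.
    by apply: eq_integral => s _; rewrite exprD mulrA.
  rewrite -(@integral_polar _ _ (fun w => dot v w ^+ (2 * j))
    (fun s => s ^+ (2 * j) * gauss_fun s)).
  - apply: eq_integral => y _; congr EFin.
    by rewrite mulrA -exprMn dot_tnormalize.
  - by apply: measurable_funX; exact: measurable_dot.
  - by move=> w; exact: even_expr_ge0.
  - by apply: measurable_funM => //; exact: measurable_gauss_fun.
  - by move=> s; rewrite mulr_ge0 ?even_expr_ge0 ?gauss_fun_ge0.
(* The radial integral is a positive real, so it can be cancelled although [I] is not yet known to
   be finite. *)
have -> : I = (I * (half_gauss_moment R (n + 2 * j))%:E *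
    (half_gauss_moment R (n + 2 * j))^-1%:E)%E.
  by rewrite -muleA -EFinM divff ?gt_eqF// mule1.
rewrite e -EFinM; congr EFin; rewrite /sphere_moment Gamma_shift.
by field; rewrite gt_eqF.
Qed.

(** The total mass is the even moment of order 0. *)
Lemma surface_measure_finite : (sigma S < +oo)%E.
Proof.
have := ereal_sphere_integral_even (fun=> 0) 0.
under eq_integral do rewrite muln0 expr0.
rewrite integral_cst; last exact: measurable_unit_sphere.
by rewrite mul1e => ->; rewrite ltry.
Qed.

(** Expand |v - <v, w> w|^2 >= 0 using |w| = 1. *)
Lemma cauchy_schwarz_sphere (v : 'I_m -> R) (w : vecT) :
  S w -> dot v w ^+ 2 <= \sum_i v i ^+ 2.
Proof.
move=> Sw; have w1 : \sum_i tnth w i ^+ 2 = 1 by rewrite -sqr_tnorm Sw expr1n.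
have : 0 <= \sum_i (v i - dot v w * tnth w i) ^+ 2 by apply: sumr_ge0 => i _; exact: sqr_ge0.
have sq (a b c : R) : (a - b * c) ^+ 2 = a ^+ 2 - 2 * b * (a * c) + b ^+ 2 * c ^+ 2 by ring.
have sqs (d : R) : \sum_i (v i - d * tnth w i) ^+ 2 =
    \sum_i v i ^+ 2 - 2 * d * (\sum_i v i * tnth w i) + d ^+ 2 * \sum_i tnth w i ^+ 2.
  by rewrite !mulr_sumr -sumrB -big_split/=; apply: eq_bigr => i _; exact: sq.
rewrite sqs w1 -/(dot v w); nra.
Qed.

Lemma normr_dot_sphere (v : 'I_m -> R) (w : vecT) :
  S w -> `|dot v w| <= Num.sqrt (\sum_i v i ^+ 2).
Proof.
by move=> Sw; rewrite -sqrtr_sqr; apply: ler_wsqrtr; exact: cauchy_schwarz_sphere.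
Qed.

Lemma normr_coord_sphere (w : vecT) i : S w -> `|tnth w i| <= 1.
Proof.
move=> Sw; have := @normr_dot_sphere (fun k => (k == i)%:R) w Sw.
rewrite /dot (bigD1 i)//= eqxx mul1r big1 ?addr0 => [|k /negbTE ->]; last by rewrite mul0r.
rewrite (bigD1 i)//= eqxx expr1n big1 ?addr0 ?sqrtr1// => k /negbTE ->.
by rewrite expr0n.
Qed.

Lemma bounded_sphere_integrable (g : vecT -> R) (M : R) :
  measurable_fun S g -> (forall w, S w -> `|g w| <= M) -> sigma.-integrable S (EFin \o g).
Proof.
move=> mg gM; apply: measurable_bounded_integrable => //.
- exact: measurable_unit_sphere.
- exact: surface_measure_finite.
- exists M; split; first exact: num_real.
  by move=> N MN w Sw; exact: (le_trans (gM _ Sw) (ltW MN)).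
Qed.

Lemma sphere_integral_even (v : 'I_m -> R) j :
  \int[sigma]_(w in S) (dot v w ^+ (2 * j)) = sphere_moment j * (\sum_i v i ^+ 2) ^+ j.
Proof. by rewrite /Rintegral ereal_sphere_integral_even. Qed.

Lemma Rintegral_sum_sphere (I : finType) (g : I -> vecT -> R) :
  (forall i, sigma.-integrable S (EFin \o g i)) ->
  \int[sigma]_(w in S) (\sum_i g i w) = \sum_i \int[sigma]_(w in S) g i w.
Proof.
move=> ig; rewrite /Rintegral.
under eq_integral do rewrite -sumEFin.
rewrite (integral_sum (@measurable_unit_sphere R m) ig).
rewrite (eq_bigr (fun i => (fine (\int[sigma]_(w in S) (g i w)%:E)%E)%:E)).
  by rewrite sumEFin.
move=> i _; rewrite fineK//.
by apply: integrable_fin_num; [exact: measurable_unit_sphere|exact: ig].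
Qed.

Lemma integrable_dot_coord (v : 'I_m -> R) k a b :
  sigma.-integrable S (EFin \o (fun w => dot v w ^+ a * tnth w k ^+ b)).
Proof.
apply: (@bounded_sphere_integrable _ (Num.sqrt (\sum_i v i ^+ 2) ^+ a)).
  apply: measurable_funTS; apply: measurable_funM; apply: measurable_funX.
    exact: measurable_dot.
  exact: measurable_coord.
move=> w Sw; rewrite normrM !normrX -[leRHS]mulr1; apply: ler_pM.
- exact: exprn_ge0.
- exact: exprn_ge0.
- by apply: lerXn2r; rewrite ?nnegrE ?sqrtr_ge0//; exact: normr_dot_sphere.
- by apply: exprn_ile1 => //; exact: normr_coord_sphere.
Qed.

(* Compare the coefficients of s in the even moments of v + s e_k. *)
Lemma sphere_integral_odd (v : 'I_m -> R) k j :
  \int[sigma]_(w in S) (dot v w ^+ (2 * j).+1 * tnth w k) =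
  sphere_moment j.+1 * (v k * (\sum_i v i ^+ 2) ^+ j).
Proof.
pose J i := \int[sigma]_(w in S) (dot v w ^+ (2 * j.+1 - i) * tnth w k ^+ i).
(* As functions of s, [p] is the binomial expansion of the integral of <v + s e_k, w>^(2j+2), and
   [q] is its closed form through |v + s e_k|^2 = s^2 + 2 v_k s + |v|^2. *)
pose p : {poly R} := \poly_(i < (2 * j.+1).+1) ('C(2 * j.+1, i)%:R * J i).
pose q : {poly R} := sphere_moment j.+1 *:
  ('X^2 + (2 * v k) *: 'X + (\sum_i v i ^+ 2)%:P) ^+ j.+1.
have pq : p = q.
  apply: poly_eq_horner => s.
  pose u i := v i + s * (i == k)%:R.
  have uk w : dot u w = dot v w + s * tnth w k.
    rewrite /dot; under eq_bigr do rewrite mulrDl.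
    rewrite big_split/= (bigD1 k)//= [X in _ + X](bigD1 k)//= eqxx mulr1.
    rewrite [X in _ + (_ + X)]big1 => [|i /negbTE ->]; last by rewrite mulr0 mul0r.
    by rewrite addr0.
  have u2 : \sum_i u i ^+ 2 = s ^+ 2 + 2 * v k * s + \sum_i v i ^+ 2.
    rewrite (bigD1 k)//= [in RHS](bigD1 k)//= /u eqxx mulr1.
    rewrite (eq_bigr (fun i => v i ^+ 2)) => [|i /negbTE ->]; first by ring.
    by rewrite mulr0 addr0.
  rewrite horner_poly /q hornerZ horner_exp !hornerD hornerXn hornerZ hornerX hornerC.
  rewrite -u2 -sphere_integral_even.
  under eq_Rintegral do rewrite uk exprDn.
  have alg (a b c d : R) : a * (b * c) * d = d * b * (a * c) by ring.
  have fE (i : 'I_(2 * j.+1).+1) :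
      (fun w : vecT => dot v w ^+ (2 * j.+1 - i) * (s * tnth w k) ^+ i *+ 'C(2 * j.+1, i)) =
      (fun w => ('C(2 * j.+1, i)%:R * s ^+ i) * (dot v w ^+ (2 * j.+1 - i) * tnth w k ^+ i)).
    apply/funext => w; rewrite exprMn -mulr_natr.
    exact: alg.
  rewrite Rintegral_sum_sphere => [|i].
    apply: eq_bigr => i _; rewrite fE RintegralZl.
    - by rewrite /J mulrAC.
    - exact: measurable_unit_sphere.
    - exact: integrable_dot_coord.
  rewrite fE; have := integrableZl (@measurable_unit_sphere R m) ('C(2 * j.+1, i)%:R * s ^+ i)
    (integrable_dot_coord v k (2 * j.+1 - i) i).
  by apply: eq_integrable => //; exact: measurable_unit_sphere.
have q1 : q`_1 = sphere_moment j.+1 * (2 * v k * (\sum_i v i ^+ 2) ^+ j *+ j.+1).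
  rewrite -[q`_1]mulr1n -coef_deriv -horner_coef0 /q derivZ hornerZ; congr (_ * _).
  rewrite deriv_exp hornerMn hornerM !derivD derivXn derivZ derivX derivC.
  rewrite horner_exp !hornerD !hornerZ !(hornerXn, hornerC).
  by rewrite !expr0n/= ?expr1 !mulr0 mulr1 !add0r addr0.
have p1 : p`_1 = (2 * j.+1)%:R * J 1%N by rewrite coef_poly/= bin1.
have := congr1 (fun r : {poly R} => r`_1) pq.
rewrite p1 q1 /J.
have -> : (2 * j.+1 - 1 = (2 * j).+1)%N by rewrite mulnS.
under eq_Rintegral do rewrite expr1.
have j0 : (2 * j.+1)%:R != 0 :> R by rewrite pnatr_eq0.
move=> e; apply: (mulfI j0); rewrite e natrM -mulr_natr; ring.
Qed.

End SphereMoments.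

(** * Termwise integration *)

Section SeriesExchange.
Variable R : realType.

Lemma geometric_bound_cvg (a : R^nat) (K q : R) : 0 <= q < 1 ->
  (forall j, `|a j| <= K * q ^+ j) -> cvgn (series a).
Proof.
move=> /andP[q0 q1] aK; apply: normed_cvg; apply: (@series_le_cvg _ _ (geometric K q)).
- by move=> j; exact: normr_ge0.
- by move=> j; exact: le_trans (aK j).
- exact: aK.
- by apply: is_cvg_geometric_series; rewrite ger0_norm.
Qed.

Lemma geometric_bound_series (a : R^nat) (K q : R) n : 0 <= q < 1 ->
  (forall j, `|a j| <= K * q ^+ j) -> `|series a n| <= K / (1 - q).
Proof.
move=> /andP[q0 q1] aK.
have K0 : 0 <= K by have := le_trans (normr_ge0 _) (aK 0%N); rewrite expr0 mulr1.
apply: le_trans (ler_norm_sum _ _ _) _.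
apply: (@le_trans _ _ (series (geometric K q) n)); first by apply: ler_sum => j _; exact: aK.
rewrite geometric_seriesE ?lt_eqF//= ler_pM2r ?invr_gt0 ?subr_gt0//.
by rewrite ler_piMr// lerBlDr lerDl exprn_ge0.
Qed.

(** Dominated convergence for the partial sums: the geometric bound makes the constant K/(1-q)
    dominate them, and constants are integrable because the sphere has finite mass. *)
Lemma integral_series_sphere n (T : nat -> n.+1.-tuple (measurableTypeR R) -> R) (K q : R) :
  0 <= q < 1 -> (forall j, measurable_fun setT (T j)) ->
  (forall j w, unit_sphere w -> `|T j w| <= K * q ^+ j) ->
  let P w := limn (series (fun j => T j w)) in
  (@surface_measure R n.+1).-integrable (@unit_sphere R n.+1) (fun w => (P w)%:E) /\
  series (fun j => \int[@surface_measure R n.+1]_(w in @unit_sphere R n.+1) T j w) @ \oo -->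
    \int[@surface_measure R n.+1]_(w in @unit_sphere R n.+1) P w.
Proof.
move=> q01 mT TK P; have /andP[q0 q1] := q01.
have mS := @measurable_unit_sphere R n.+1.
have TP w : unit_sphere w -> series (fun j => T j w) @ \oo --> P w.
  by move=> Sw; apply: (geometric_bound_cvg q01) => j; exact: TK.
have TB w k : unit_sphere w -> `|series (fun j => T j w) k| <= K / (1 - q).
  by move=> Sw; apply: (geometric_bound_series _ q01) => j; exact: TK.
have mser k : measurable_fun setT (fun w => series (fun j => T j w) k).
  by apply: measurable_sum => j; exact: mT.
have mP : measurable_fun (@unit_sphere R n.+1) P.
  apply: (@measurable_fun_cvg _ _ _ _ (fun k w => series (fun j => T j w) k)) => [k|w Sw].
    exact: measurable_funTS.
  exact: TP.
have iT j : (@surface_measure R n.+1).-integrable (@unit_sphere R n.+1) (EFin \o T j).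
  apply: (@bounded_sphere_integrable _ _ _ (K * q ^+ j)); first exact: measurable_funTS.
  by move=> w; exact: TK.
have mserE k : measurable_fun (@unit_sphere R n.+1) (fun w => (series (fun j => T j w) k)%:E).
  by apply/measurable_EFinP; exact: measurable_funTS.
have mPE : measurable_fun (@unit_sphere R n.+1) (fun w => (P w)%:E) by exact/measurable_EFinP.
pose g (w : n.+1.-tuple (measurableTypeR R)) : \bar R := (K / (1 - q))%:E.
have cstI : (@surface_measure R n.+1).-integrable (@unit_sphere R n.+1) g.
  apply: (@bounded_sphere_integrable _ _ (fun=> K / (1 - q)) `|K / (1 - q)|).
    exact: measurable_cst.
  by move=> w _; rewrite lexx.
have TPE : {ae @surface_measure R n.+1, forall w, unit_sphere w ->
    (series (fun j => T j w) k)%:E @[k --> \oo] --> (P w)%:E}.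
  apply: aeW => w Sw; apply: cvg_EFin; first exact: nearW.
  exact: TP.
have TBE : {ae @surface_measure R n.+1, forall w k, unit_sphere w ->
    (`|(series (fun j => T j w) k)%:E| <= g w)%E}.
  by apply: aeW => w k Sw; rewrite /= lee_fin; exact: TB.
have [iP _ lP] := dominated_convergence mS mserE mPE TPE cstI TBE.
split; first exact: iP.
have PE : (\int[@surface_measure R n.+1]_(w in @unit_sphere R n.+1) (P w)%:E)%E =
    (\int[@surface_measure R n.+1]_(w in @unit_sphere R n.+1) P w)%:E.
  by rewrite /Rintegral fineK//; apply: integrable_fin_num.
rewrite PE in lP; move/fine_cvgP : lP => [_ lP].
rewrite (_ : series _ = fine \o (fun k => \int[@surface_measure R n.+1]_(w in @unit_sphere R n.+1)
  (series (fun j => T j w) k)%:E)%E); first exact: lP.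
apply/funext => k; rewrite /series/= big_mkord.
rewrite -(Rintegral_sum_sphere (g := fun (j : 'I_k) w => T j w)); last by move=> j; exact: iT.
by rewrite /Rintegral; congr fine; apply: eq_integral => w _; rewrite big_mkord.
Qed.

End SeriesExchange.

(** * Growth of the factor between the two kinds of series *)

Section Growth.
Variable R : realType.

(** The quotient of consecutive terms is q (n+1+2j)/(2j+1). It tends to q < 1, so the sequence is
    eventually nonincreasing. *)
Lemma Gamma_gauss_coef_growth n (q : R) : 0 <= q < 1 ->
  exists C, forall j, Gamma (n.+1%:R / 2 + j%:R) / gauss_coef R j * q ^+ j <= C.
Proof.
move=> /andP[q0 q1].
pose u j : R := Gamma (n.+1%:R / 2 + j%:R) / gauss_coef R j * q ^+ j.
have u0 j : 0 <= u j.
  by rewrite mulr_ge0 ?exprn_ge0// ltW// divr_gt0 ?Gamma_shift_gt0 ?gauss_coef_gt0.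
have uS j : u j.+1 = u j * (q * (n.+1%:R + 2 * j%:R) / (2 * j%:R + 1)).
  rewrite /u !Gamma_shift gauss_coefS (_ : (n + 2 * j.+1 = (n + 2 * j).+2)%N); last first.
    by rewrite mulnS addnCA.
  have e1 : (n + 2 * j).+1%:R = n.+1%:R + 2 * j%:R :> R by rewrite -addSn natrD natrM.
  have e2 : (2 * j).+1%:R = 2 * j%:R + 1 :> R by rewrite -natr1 natrM.
  rewrite half_gauss_momentSS exprS e1 e2.
  have c0 : gauss_coef R j != 0 by rewrite gt_eqF ?gauss_coef_gt0.
  have d0 : 2 * j%:R + 1 != 0 :> R by rewrite -natrM natr1 pnatr_eq0.
  by field; rewrite c0 d0.
(* The quotient is at most 1 when q (n+1) <= 2j (1-q) + 1, for which j (1-q) >= n+1 suffices. *)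
pose N := (Num.truncn (n.+1%:R / (1 - q))).+1.
have NP j : (N <= j)%N -> u j.+1 <= u j.
  move=> Nj; rewrite uS ler_piMr// ler_pdivrMr ?mul1r; last by rewrite ltr_wpDl.
  have : n.+1%:R / (1 - q) <= j%:R.
    by apply: ltW; apply: lt_le_trans (truncnS_gt _) _; rewrite ler_nat.
  rewrite ler_pdivrMr ?subr_gt0// => h.
  have n0 : 0 <= n.+1%:R :> R by [].
  have j0 : 0 <= j%:R :> R by [].
  nra.
exists (\sum_(i < N.+1) u i) => j.
have small i : (i <= N)%N -> u i <= \sum_(i < N.+1) u i.
  move=> iN; rewrite (bigD1 (Ordinal (iN : (i < N.+1)%N)))//= lerDl.
  by apply: sumr_ge0 => k _; exact: u0.
have [/small//|/ltnW Nj] := leqP j N.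
apply: le_trans (small N (leqnn N)); rewrite -/(u j) -(subnKC Nj).
elim: (j - N)%N => [|k IH]; first by rewrite addn0.
by rewrite addnS; apply: le_trans IH; apply: NP; exact: leq_addr.
Qed.

End Growth.

(** * Plane waves *)

Section CliffordCoordinates.
Variables (R : comNzRingType) (m : nat).
Local Notation Cl := (clifford R m).

Lemma coord_sum (I : Type) (r : seq I) (P : pred I) (F : I -> Cl) B :
  (\sum_(i <- r | P i) F i) B = \sum_(i <- r | P i) F i B.
Proof.
elim/big_rec2: _ => [|i a u _ <-]; first exact: Defs.coord0.
exact: coordD.
Qed.

(** Left multiplication by e_k permutes the basis blades up to sign, so only one summand of the
    product survives. Coordinatewise limits and bounds thus pass through Clifford products. *)
Lemma coord_gen_mul (k : 'I_m) (u : Cl) B :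
  (gen R k * u) B =
    blade_sign R [set k]%SET (symdiff [set k]%SET B) * u (symdiff [set k]%SET B).
Proof.
rewrite [LHS]Defs.coordE (bigD1 [set k]%SET)//= Defs.coordE eqxx mulr1.
rewrite big1 ?addr0// => A /negbTE Ak.
by rewrite Defs.coordE Ak mulr0 mul0r.
Qed.

End CliffordCoordinates.

Section PlaneWaves.
Variables (R : realType) (n : nat).
Local Notation m := n.+1.
Local Notation Cl := (clifford R m).
Local Notation point := 'rV[R]_m.+1.
Local Notation vecT := (m.-tuple (measurableTypeR R)).
Implicit Types (A : R -> Cl) (x : point) (w : vecT).

Definition imf x (j : 'I_m) : R := im x ord0 j.

Lemma coord_vec_mul (v : 'rV[R]_m) (u : Cl) B :
  (vec v * u) B = \sum_k v ord0 k * (gen R k * u) B.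
Proof.
rewrite /vec mulr_suml coord_sum; apply: eq_bigr => k _.
by rewrite -clifford_scalerAl coordZ.
Qed.

Lemma dotp_row_of x w : dotp (im x) (row_of w) = dot (imf x) w.
Proof. by apply: eq_bigr => j _; rewrite [row_of w ord0 j]mxE. Qed.

Lemma sqr_enorm x : enorm (im x) ^+ 2 = \sum_j imf x j ^+ 2.
Proof. by rewrite sqr_sqrtr// sumr_ge0// => j _; exact: sqr_ge0. Qed.

Lemma exists_larger_im (O : set point) x : open O -> O x ->
  exists y, [/\ O y, re y = re x & enorm (im x) < enorm (im y)].
Proof.
move=> oO Ox.
pose k : 'I_m := ord0.
(* The chosen coordinate is moved away from 0, which lengthens the vector part even if it was 0. *)
pose sg : R := if 0 <= imf x k then 1 else -1.
pose y (e : R) : point := x + (e * sg) *: delta_mx ord0 (lift ord0 k).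
have cy : y e @[e --> 0] --> x.
  have : y e @[e --> 0] --> x + (0 * sg) *: delta_mx ord0 (lift ord0 k).
    apply: cvgD; first exact: cvg_cst.
    by apply: cvgZr_tmp; apply: cvgM; [exact: cvg_id|exact: cvg_cst].
  by rewrite mul0r scale0r addr0.
have Oy : \forall e \near (0 : R), O (y e) by apply: cy; exact: open_nbhs_nbhs.
have [e /= e0 Oye] : exists2 e : R, 0 < e & O (y e).
  have [d /= d0 dO] := (nbhs_ballP _ _).1 Oy.
  exists (d / 2); first by rewrite divr_gt0.
  apply: dO; rewrite /ball/= sub0r normrN gtr0_norm ?divr_gt0//.
  by rewrite ltr_pdivrMr// ltr_pMr// ltr1n.
exists (y e); split => //.
  by rewrite /re !mxE/= mulr0 addr0.
have ye j : im (y e) ord0 j = im x ord0 j + e * sg * (j == k)%:R.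
  by rewrite !mxE/= (inj_eq lift_inj).
have lt_sum : \sum_j im x ord0 j ^+ 2 < \sum_j im (y e) ord0 j ^+ 2.
  rewrite (bigD1 k)//= [ltRHS](bigD1 k)//=.
  rewrite [X in _ < _ + X](eq_bigr (fun j => im x ord0 j ^+ 2)) => [|j /negbTE jk].
    rewrite ltrD2r ye eqxx mulr1 /sg /imf.
    by case: ifPn => [v0|]; last rewrite -ltNge => v0; nra.
  by rewrite ye jk mulr0 addr0.
rewrite /enorm ltr_sqrt//; apply: le_lt_trans lt_sum.
by apply: sumr_ge0 => j _; exact: sqr_ge0.
Qed.

Lemma powR_pi_half k : pi `^ (k%:R / 2) = Num.sqrt pi ^+ k :> R.
Proof.
rewrite -powR12_sqrt ?pi_ge0// -powR_mulrn ?powR_ge0// -powRrM.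
by rewrite mulrC.
Qed.

Lemma has_sum_vec_mul (v : 'rV[R]_m) (u : nat -> Cl) (s : Cl) :
  has_sum u s -> has_sum (fun j => vec v * u j) (vec v * s).
Proof.
move=> us B; rewrite coord_vec_mul.
rewrite (_ : series _ = fun N => \sum_k v ord0 k *
  (blade_sign R [set k]%SET (symdiff [set k]%SET B) *
    series (fun j => u j (symdiff [set k]%SET B)) N)).
  apply: cvg_big => [|k _]; first exact: add_continuous.
  rewrite coord_gen_mul.
  by apply: cvgM; [exact: cvg_cst|apply: cvgM; [exact: cvg_cst|exact: us]].
apply/funext => N; rewrite /series/=.
under eq_bigr do rewrite coord_vec_mul.
rewrite exchange_big/=; apply: eq_bigr => k _.
by rewrite !mulr_sumr; apply: eq_bigr => j _; rewrite coord_gen_mul.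
Qed.

(** The left side equals the absolute value of the term at [r'], times Gamma / [gauss_coef], times
    (r/r')^(2j). The first factor is bounded by convergence, the second by [C] together with one
    power (r/r')^j; the other power remains. The index [k] is free so that both the even and the odd
    series are covered. *)
Lemma derivative_growth k (D : nat -> R) (r r' : R) : 0 <= r < r' ->
  cvgn (series (fun j => ((-1) ^+ j * r' ^+ (2 * j) /
    (2 ^+ (2 * j) * j`!%:R * Gamma (k.+1%:R / 2 + j%:R))) * D j)) ->
  exists K, forall j, r ^+ (2 * j) * `|D j| / (2 * j)`!%:R <= K * (r / r') ^+ j.
Proof.
move=> /andP[r0 rr'] /cvg_series_cvg_0/cvgP cu.
have r'0 : 0 < r' by exact: le_lt_trans rr'.
have q01 : 0 <= r / r' < 1 by rewrite divr_ge0 ?(ltW r'0)//= ltr_pdivrMr// mul1r.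
have q0 : 0 <= r / r' by case/andP: q01.
have [C HC] := Gamma_gauss_coef_growth k q01.
have [M [_ /(_ (M + 1)) HM]] := cvg_seq_bounded cu.
have {HM} HM : forall j, `|((-1) ^+ j * r' ^+ (2 * j) /
    (2 ^+ (2 * j) * j`!%:R * Gamma (k.+1%:R / 2 + j%:R))) * D j| <= M + 1.
  by move=> j; apply: HM => //; rewrite ltrDl.
exists ((M + 1) * C) => j.
have G0 := Gamma_shift_gt0 R k j.
have g0 := gauss_coef_gt0 R j.
apply: (@le_trans _ _ (`|((-1) ^+ j * r' ^+ (2 * j) /
    (2 ^+ (2 * j) * j`!%:R * Gamma (k.+1%:R / 2 + j%:R))) * D j| *
  (Gamma (k.+1%:R / 2 + j%:R) / gauss_coef R j * (r / r') ^+ j) * (r / r') ^+ j)); last first.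
  apply: ler_wpM2r; first exact: exprn_ge0.
  apply: ler_pM; [exact: normr_ge0| |exact: HM|exact: HC].
  by rewrite mulr_ge0 ?exprn_ge0// ltW// divr_gt0.
have f0 i : i`!%:R != 0 :> R by rewrite pnatr_eq0 -lt0n fact_gt0.
rewrite !normrM normrX normrN1 expr1n mul1r.
rewrite [`|r' ^+ _|]ger0_norm ?exprn_ge0 ?(ltW r'0)// [`|_^-1|]ger0_norm; last first.
  by rewrite invr_ge0 mulr_ge0 ?(ltW G0)// mulr_ge0 ?exprn_ge0.
rewrite /gauss_coef [2 ^+ (2 * j)]exprM (_ : 2 ^+ 2 = 4 :> R); last by rewrite -natrX.
rewrite [r ^+ (2 * j)]exprM [r' ^+ (2 * j)]exprM !expr_div_n.
rewrite -![_ ^+ 2 ^+ j]exprM ![(2 * j)%N]mulnC ![_ ^+ (j * 2)]exprM.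
have p4 : 4 ^+ j != 0 :> R by rewrite expf_neq0// pnatr_eq0.
have pr : r' ^+ j != 0 by rewrite expf_neq0// gt_eqF.
rewrite le_eqVlt; apply/orP; left; apply/eqP; field.
by rewrite pr p4 !f0 (gt_eqF G0).
Qed.

Lemma cosh_term_coord A x w j B : cosh_term A x w j B =
  (-1) ^+ j / (2 * j)`!%:R * cderivn (2 * j) A (re x) B * dot (imf x) w ^+ (2 * j).
Proof. by rewrite coordZ dotp_row_of; ring. Qed.

Lemma sinh_term_coord A x w j B : sinh_term A x w j B =
  \sum_k (-1) ^+ j / ((2 * j).+1)`!%:R * (gen R k * cderivn (2 * j) A (re x)) B *
    (dot (imf x) w ^+ (2 * j).+1 * tnth w k).
Proof.
rewrite coordZ dotp_row_of coord_vec_mul mulr_sumr; apply: eq_bigr => k _.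
rewrite mxE.
have alg (a b c d e : R) : a * b / c * (d * e) = a / c * e * (b * d) by ring.
exact: alg.
Qed.

Lemma cosh_term_bound A x y s B : re y = re x -> enorm (im x) < enorm (im y) ->
  has_sum (even_term A y) s -> exists K, forall j w, unit_sphere w ->
  `|cosh_term A x w j B| <= K * (enorm (im x) / enorm (im y)) ^+ j.
Proof.
move=> yx lt_xy As.
have r01 : 0 <= enorm (im x) < enorm (im y) by rewrite sqrtr_ge0.
have cA : cvgn (series (fun j => ((-1) ^+ j * enorm (im y) ^+ (2 * j) /
    (2 ^+ (2 * j) * j`!%:R * Gamma (m%:R / 2 + j%:R))) * cderivn (2 * j) A (re x) B)).
  apply/cvg_ex; exists (s B); move: (As B); rewrite /even_term yx.
  by under eq_fun do rewrite coordZ.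
have [K HK] := derivative_growth r01 cA.
exists K => j w Sw; apply: le_trans (HK j).
have f0 : 0 <= ((2 * j)`!%:R : R)^-1 by rewrite invr_ge0.
rewrite cosh_term_coord !normrM !normrX normrN1 expr1n mul1r (ger0_norm f0).
have alg (a b c : R) : a * b * c = c * b * a by ring.
rewrite [leRHS]alg; apply: ler_wpM2l; first exact: mulr_ge0.
by apply: lerXn2r; rewrite ?nnegrE ?sqrtr_ge0//; exact: normr_dot_sphere.
Qed.

Lemma sinh_term_bound A x y s B : re y = re x -> enorm (im x) < enorm (im y) ->
  has_sum (odd_term A y) s -> exists K, forall j w, unit_sphere w ->
  `|sinh_term A x w j B| <= K * (enorm (im x) / enorm (im y)) ^+ j.
Proof.
move=> yx lt_xy As.
have r0 : 0 <= enorm (im x) by exact: sqrtr_ge0.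
have r01 : 0 <= enorm (im x) < enorm (im y) by rewrite sqrtr_ge0.
(* Since m/2 + j + 1 = (n+3)/2 + j, the odd series has the coefficients of the even series in
   dimension m + 2. *)
have cA B' : cvgn (series (fun j => ((-1) ^+ j * enorm (im y) ^+ (2 * j) /
    (2 ^+ (2 * j) * j`!%:R * Gamma (n.+3%:R / 2 + j%:R))) * cderivn (2 * j) A (re x) B')).
  apply/cvg_ex; exists (s B'); move: (As B'); rewrite /odd_term yx.
  under eq_fun do rewrite coordZ.
  have mE j : m%:R / 2 + j%:R + 1 = n.+3%:R / 2 + j%:R :> R.
    by rewrite -[n.+3]addn2 natrD; field.
  by under eq_fun do rewrite mE.
have /choice[K HK] : forall k, exists K, forall j,
    enorm (im x) ^+ (2 * j) * `|(gen R k * cderivn (2 * j) A (re x)) B| / (2 * j)`!%:R <=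
    K * (enorm (im x) / enorm (im y)) ^+ j.
  move=> k; have [K HK] := derivative_growth r01 (cA (symdiff [set k]%SET B)).
  exists (`|blade_sign R [set k]%SET (symdiff [set k]%SET B)| * K) => j.
  rewrite coord_gen_mul normrM mulrCA -!mulrA ler_wpM2l// mulrA; exact: HK.
(* The factor |x| pays for the odd power of <x, w>; the sum runs over the components of w, each at
   most 1 in absolute value. *)
exists (enorm (im x) * \sum_k K k) => j w Sw.
rewrite sinh_term_coord (le_trans (ler_norm_sum _ _ _))// -mulrA mulr_suml mulr_sumr.
apply: ler_sum => k _.
apply: (@le_trans _ _ (enorm (im x) * (enorm (im x) ^+ (2 * j) *
   `|(gen R k * cderivn (2 * j) A (re x)) B| / (2 * j)`!%:R))); last first.
  by apply: ler_wpM2l => //; exact: HK.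
have f0 : 0 <= ((2 * j).+1`!%:R : R)^-1 by rewrite invr_ge0.
rewrite !normrM !normrX normrN1 expr1n mul1r (ger0_norm f0).
have alg1 (a b c : R) : a * b * c = c * (b * a) by ring.
have alg2 (a b c d : R) : a * (b * c * d) = (a * b) * (c * d) by ring.
rewrite [leLHS]alg1 [leRHS]alg2 -exprS; apply: ler_pM.
- by apply: mulr_ge0 => //; exact: exprn_ge0.
- exact: mulr_ge0.
- rewrite -[leRHS]mulr1; apply: ler_pM.
  + exact: exprn_ge0.
  + exact: normr_ge0.
  + by apply: lerXn2r; rewrite ?nnegrE ?sqrtr_ge0//; exact: normr_dot_sphere.
  + exact: normr_coord_sphere.
- apply: ler_wpM2l => //; rewrite lef_pV2 ?posrE ?ltr0n ?fact_gt0// ler_nat.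
  by rewrite factS leq_pmull.
Qed.

End PlaneWaves.

(** * Integrals of plane waves over the sphere *)

Section PlaneWaveIntegrals.
Variables (R : realType) (n : nat).
Local Notation m := n.+1.
Local Notation Cl := (clifford R m).
Local Notation point := 'rV[R]_m.+1.
Local Notation vecT := (m.-tuple (measurableTypeR R)).
Local Notation sigma := (@surface_measure R m).
Local Notation S := (@unit_sphere R m).
Implicit Types (A : R -> Cl) (x : point).

Lemma pi_powR_gt0 : 0 < 2 * pi `^ (m%:R / 2) :> R.
Proof. by rewrite mulr_gt0// powR_gt0// pi_gt0. Qed.

Lemma measurable_dot_coord (v : 'I_m -> R) k a b :
  measurable_fun setT (fun w : vecT => dot v w ^+ a * tnth w k ^+ b).
Proof.
apply: measurable_funM; apply: measurable_funX; first exact: measurable_dot.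
exact: measurable_coord.
Qed.

(** The trivial power [tnth w ord0 ^+ 0] gives the term the shape shared with [sinh_term_dot], so
    one measurability and one integrability lemma serve both. *)
Lemma cosh_term_dot A x j B : (fun w : vecT => cosh_term A x w j B) =
  (fun w => (-1) ^+ j / (2 * j)`!%:R * cderivn (2 * j) A (re x) B *
    (dot (imf x) w ^+ (2 * j) * tnth w ord0 ^+ 0)).
Proof. by apply/funext => w; rewrite cosh_term_coord mulr1. Qed.

Lemma sinh_term_dot A x j B : (fun w : vecT => sinh_term A x w j B) =
  (fun w => \sum_k (-1) ^+ j / ((2 * j).+1)`!%:R * (gen R k * cderivn (2 * j) A (re x)) B *
    (dot (imf x) w ^+ (2 * j).+1 * tnth w k ^+ 1)).
Proof. by apply/funext => w; rewrite sinh_term_coord. Qed.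

Lemma measurable_cosh_term A x j B : measurable_fun setT (fun w : vecT => cosh_term A x w j B).
Proof.
rewrite cosh_term_dot; apply: measurable_funM; first exact: measurable_cst.
exact: measurable_dot_coord.
Qed.

Lemma measurable_sinh_term A x j B : measurable_fun setT (fun w : vecT => sinh_term A x w j B).
Proof.
rewrite sinh_term_dot; apply: measurable_sum => k.
by apply: measurable_funM; [exact: measurable_cst|exact: measurable_dot_coord].
Qed.

Lemma integrableZ_dot_coord (c : R) (v : 'I_m -> R) k a b :
  sigma.-integrable S (EFin \o (fun w => c * (dot v w ^+ a * tnth w k ^+ b))).
Proof.
have := integrableZl (@measurable_unit_sphere R n.+1) c (integrable_dot_coord v k a b).
by apply: eq_integrable => //; exact: measurable_unit_sphere.
Qed.

Lemma integrable_cosh_term A x j B :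
  sigma.-integrable S (EFin \o (fun w => cosh_term A x w j B)).
Proof. rewrite cosh_term_dot; exact: integrableZ_dot_coord. Qed.

Lemma integrable_sinh_term A x j B :
  sigma.-integrable S (EFin \o (fun w => sinh_term A x w j B)).
Proof.
rewrite sinh_term_dot.
apply: (eq_integrable (@measurable_unit_sphere R n.+1) (fun w : vecT => (\sum_(k < m)
  ((-1) ^+ j / ((2 * j).+1)`!%:R * (gen R k * cderivn (2 * j) A (re x)) B *
    (dot (imf x) w ^+ (2 * j).+1 * tnth w k ^+ 1))%:E)%E)).
  by move=> w _; rewrite /= sumEFin.
apply: integrable_sum; first exact: measurable_unit_sphere.
by move=> k _; exact: integrableZ_dot_coord.
Qed.

(** The (2j)! of cosh cancels the numerator of [gauss_coef j], which leaves the denominator 4^j j!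
    Gamma(m/2 + j) of [even_term]. *)
Lemma integral_cosh_term A x j B :
  \int[sigma]_(w in S) cosh_term A x w j B = 2 * pi `^ (m%:R / 2) * even_term A x j B.
Proof.
rewrite cosh_term_dot RintegralZl; last 2 first.
- exact: measurable_unit_sphere.
- exact: integrable_dot_coord.
under eq_Rintegral do rewrite mulr1.
rewrite sphere_integral_even -sqr_enorm -exprM coordZ powR_pi_half /sphere_moment /gauss_coef.
rewrite [2 ^+ (2 * j)]exprM (_ : 2 ^+ 2 = 4 :> R); last by rewrite -natrX.
have f0 i : i`!%:R != 0 :> R by rewrite pnatr_eq0 -lt0n fact_gt0.
have p4 : 4 ^+ j != 0 :> R by rewrite expf_neq0// pnatr_eq0.
have G0 : Gamma (m%:R / 2 + j%:R) != 0 :> R by rewrite gt_eqF// Gamma_shift_gt0.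
move: (Gamma _) G0 => G G0; move: (cderivn _ _ _ _) => D.
move: (enorm _ ^+ _) (Num.sqrt _ ^+ _) => p q.
by field; rewrite !f0 p4 G0.
Qed.

(** The moment has index j+1, and [gauss_coefS] splits off (2j+1)/2. The factor 2j+1 reduces (2j+1)!
    to (2j)!, and the remaining 1/2 turns the coefficient m of sinh into the m/2 of the odd
    series. *)
Lemma integral_sinh_term A x j B :
  m%:R * \int[sigma]_(w in S) sinh_term A x w j B =
  2 * pi `^ (m%:R / 2) * (m%:R / 2 * (vec (im x) * odd_term A x j) B).
Proof.
rewrite sinh_term_dot Rintegral_sum_sphere; last by move=> k; exact: integrableZ_dot_coord.
rewrite coord_vec_mul !mulr_sumr; apply: eq_bigr => k _.
rewrite RintegralZl; last 2 first.
- exact: measurable_unit_sphere.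
- exact: integrable_dot_coord.
under eq_Rintegral do rewrite expr1.
rewrite sphere_integral_odd -sqr_enorm -exprM powR_pi_half /sphere_moment gauss_coefS.
rewrite -clifford_scalerAr coordZ -/(imf x k).
rewrite [m%:R / 2 + j.+1%:R](_ : _ = m%:R / 2 + j%:R + 1).
  rewrite /gauss_coef [(2 * j).+1`!]factS natrM.
  rewrite [2 ^+ (2 * j)]exprM (_ : 2 ^+ 2 = 4 :> R); last by rewrite -natrX.
  have f0 i : i`!%:R != 0 :> R by rewrite pnatr_eq0 -lt0n fact_gt0.
  have p4 : 4 ^+ j != 0 :> R by rewrite expf_neq0// pnatr_eq0.
  have G0 : Gamma (m%:R / 2 + j%:R + 1) != 0 :> R.
    by rewrite -addrA natr1 gt_eqF// Gamma_shift_gt0.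
  have j0 : (2 * j).+1%:R != 0 :> R by rewrite pnatr_eq0.
  move: (Gamma _) G0 => G G0; move: ((gen _ _ * _) B) (imf x k) => D v.
  move: (enorm _ ^+ _) (Num.sqrt _ ^+ _) ((2 * j).+1%:R : R) j0 (m%:R : R) => p q o o0 M.
  by field; rewrite !f0 p4 G0 o0.
by rewrite -[j.+1%:R]natr1 addrA.
Qed.

(** The sums at [y] only supply bounds that are uniform on the sphere; the value of the integral is
    identified by the sums at [x]. *)
Lemma plane_wave_decomposition A0 A1 x y (s0 s1 t0 t1 : Cl) :
  re y = re x -> enorm (im x) < enorm (im y) ->
  has_sum (even_term A0 x) s0 -> has_sum (odd_term A1 x) s1 ->
  has_sum (even_term A0 y) t0 -> has_sum (odd_term A1 y) t1 ->
  [/\ forall w, unit_sphere w ->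
        is_summable (cosh_term A0 x w) /\ is_summable (sinh_term A1 x w),
      sphere_integrable (plane_wave A0 A1 x)
    & sphere_int (plane_wave A0 A1 x) =
      (2 * pi `^ (m%:R / 2)) *: (s0 + (m%:R / 2) *: (vec (im x) * s1))].
Proof.
move=> yx lt_xy E0 O1 E0y O1y.
set q := enorm (im x) / enorm (im y).
have q01 : 0 <= q < 1.
  have y0 : 0 < enorm (im y) by apply: le_lt_trans lt_xy; exact: sqrtr_ge0.
  by rewrite divr_ge0 ?sqrtr_ge0//= ltr_pdivrMr// mul1r.
have cosh_cvg w B : S w -> cvgn (series (fun j => cosh_term A0 x w j B)).
  move=> Sw; have [K HK] := cosh_term_bound B yx lt_xy E0y.
  by apply: (geometric_bound_cvg q01) => j; exact: HK.
have sinh_cvg w B : S w -> cvgn (series (fun j => sinh_term A1 x w j B)).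
  move=> Sw; have [K HK] := sinh_term_bound B yx lt_xy O1y.
  by apply: (geometric_bound_cvg q01) => j; exact: HK.
(* Adding the two series index by index leaves a single series to dominate and to integrate. *)
pose T B j w := cosh_term A0 x w j B + m%:R * sinh_term A1 x w j B.
have TK B : exists K, forall j w, S w -> `|T B j w| <= K * q ^+ j.
  have [K0 HK0] := cosh_term_bound B yx lt_xy E0y.
  have [K1 HK1] := sinh_term_bound B yx lt_xy O1y.
  exists (K0 + m%:R * K1) => j w Sw.
  rewrite (le_trans (ler_normD _ _))// mulrDl lerD ?HK0//.
  by rewrite normrM normr_nat -mulrA ler_wpM2l ?HK1.
have mT B j : measurable_fun setT (T B j).
  apply: measurable_funD; first exact: measurable_cosh_term.
  by apply: measurable_funM; [exact: measurable_cst|exact: measurable_sinh_term].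
have PE B w : S w -> plane_wave A0 A1 x w B = limn (series (fun j => T B j w)).
  move=> Sw; rewrite coordD coordZ !Defs.coordE; apply/esym/cvg_lim => //.
  rewrite (_ : series _ = fun N => series (fun j => cosh_term A0 x w j B) N +
      m%:R * series (fun j => sinh_term A1 x w j B) N).
    by apply: cvgD; [exact: cosh_cvg|apply: cvgMl_tmp; exact: sinh_cvg].
  by apply/funext => N; rewrite /series/= mulr_sumr -big_split.
have IT B j : \int[sigma]_(w in S) T B j w =
    2 * pi `^ (m%:R / 2) * (even_term A0 x j B + m%:R / 2 * (vec (im x) * odd_term A1 x j) B).
  rewrite RintegralD; last 3 first.
  - exact: measurable_unit_sphere.
  - exact: integrable_cosh_term.
  - have := integrableZl (@measurable_unit_sphere R n.+1) m%:R (integrable_sinh_term A1 x j B).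
    by apply: eq_integrable => //; exact: measurable_unit_sphere.
  rewrite RintegralZl; last 2 first.
  - exact: measurable_unit_sphere.
  - exact: integrable_sinh_term.
  by rewrite integral_cosh_term integral_sinh_term mulrDr.
split.
- move=> w Sw; split.
    exists (csum (cosh_term A0 x w)) => B; rewrite Defs.coordE; exact: cosh_cvg.
  exists (csum (sinh_term A1 x w)) => B; rewrite Defs.coordE; exact: sinh_cvg.
- move=> B; have [K HK] := TK B.
  have [iP _] := integral_series_sphere q01 (mT B) HK.
  apply: eq_integrable iP; first exact: measurable_unit_sphere.
  by move=> w; rewrite inE => Sw; rewrite PE.
- apply: cliffordP => B; have [K HK] := TK B.
  have [_ cP] := integral_series_sphere q01 (mT B) HK.
  rewrite Defs.coordE coordZ coordD coordZ.
  transitivity (\int[sigma]_(w in S) limn (series (fun j => T B j w))).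
    by apply: eq_Rintegral => w; rewrite inE => Sw; rewrite PE.
  (* The series of termwise integrals converges to the integral by domination, and to the right side
     by the sums [s0] and [s1]. *)
  apply: (cvg_unique _ cP) => //.
  rewrite (_ : series _ = fun N => 2 * pi `^ (m%:R / 2) *
    (series (fun j => even_term A0 x j B) N +
     m%:R / 2 * series (fun j => (vec (im x) * odd_term A1 x j) B) N)).
    apply: cvgMl_tmp; apply: cvgD; first exact: E0.
    by apply: cvgMl_tmp; exact: has_sum_vec_mul.
  apply/funext => N; rewrite /series/= mulr_sumr -big_split mulr_sumr.
  by apply: eq_bigr => j _; exact: IT.
Qed.

End PlaneWaveIntegrals.

Unset Implicit Arguments.

Theorem theorem4p3 (R : realType) (m : nat) (m_gt0 : (0 < m)%N)
    (O1 : set R) (O : set 'rV[R]_m.+1)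
    (A0 A1 : R -> clifford R m) (A : nat -> R -> clifford R m)
    (f : 'rV[R]_m.+1 -> clifford R m)
    (openO1 : open O1)
    (analyticA0 : analytic_on O1 A0)
    (analyticA1 : analytic_on O1 A1)
    (nbhdO : axial_nbhd O1 O)
    (harmonicf : harmonic_on O f)
    (fA : forall x, O x -> has_sum (fun j => vec (im x) ^+ j * A j (re x)) (f x))
    (AA0 : forall t, O1 t -> A 0%N t = A0 t)
    (AA1 : forall t, O1 t -> A 1%N t = A1 t)
    (fE : forall x, O x -> exists s0 s1 : clifford R m,
      [/\ has_sum (even_term A0 x) s0,
          has_sum (odd_term A1 x) s1
        & f x = Gamma (m%:R / 2 : R) *: (s0 + (m%:R / 2) *: (vec (im x) * s1))]) :
  forall x, O x ->
    [/\ forall w, unit_sphere w ->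
          is_summable (cosh_term A0 x w) /\ is_summable (sinh_term A1 x w),
        sphere_integrable (plane_wave A0 A1 x)
      & f x = (Gamma (m%:R / 2) / (2 * pi `^ (m%:R / 2))) *:
              sphere_int (plane_wave A0 A1 x)].
Proof.
case: m m_gt0 O A0 A1 A f analyticA0 analyticA1 nbhdO harmonicf fA AA0 AA1 fE => // n _.
move=> O A0 A1 A f _ _ [oO _ _ _] _ _ _ _ fE x Ox.
have [y [Oy yx lt_xy]] := exists_larger_im oO Ox.
have [s0 [s1 [E0 O1x ->]]] := fE x Ox.
have [t0 [t1 [E0y O1y _]]] := fE y Oy.
have [sum int ->] := plane_wave_decomposition yx lt_xy E0 O1x E0y O1y.
split=> //; rewrite scalerA divfK// gt_eqF//; exact: pi_powR_gt0.
Qed.
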